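(* Let $f,g\in C^{\infty}(\mathbb{R}^n)$ be real-valued functions, let $S\subset\mathbb{R}$ be open, and let $\lambda\in\mathbb{R}$ be a regular value of $f$. If $f$ satisfies the $(g,S)$-Malgrange condition in $\lambda$, then there exists a neighborhood $U$ of $\lambda$ such that $f|_{f^{-1}(U)}$ is a trivial fibration.
   Context: Norms and inner products are Euclidean. A value $\lambda\in\mathbb{R}$ is a regular value of $f$ if $\nabla f(x)\neq 0$ for all $x\in f^{-1}(\lambda)$ (vacuously true if the fibre is empty). At points $x$ where $\nabla g(x)\neq 0$, put $$\nabla_g f(x):=\nabla f(x)-\frac{\langle\nabla f(x),\nabla g(x)\rangle}{\|\nabla g(x)\|^{2}}\nabla g(x),$$ i.e. the orthogonal projection of $\nabla f(x)$ onto the tangent space at $x$ of the fibre $g^{-1}(g(x))$. For an open set $U\subset\mathbb{R}$ and $R>0$ put $D_{(U,R)}:=f^{-1}(U)\setminus\{x\in\mathbb{R}^n : \|x\|\le R\}$. The function $f$ satisfies the $(g,S)$-Malgrange condition over $U$ if there exists $R>0$ such that: (1) $\nabla g(x)\neq 0$ for all $x\in D_{(U,R)}$; (2) $D_{(U,R)}\subset g^{-1}(S)$; (3) for every $s\in S$ there exists $\delta_s>0$ such that $\|\nabla_g f(x)\|\,\|x\|\ge\delta_s$ for all $x\in D_{(U,R)}\cap g^{-1}(s)$. The function $f$ satisfies the $(g,S)$-Malgrange condition in $\lambda\in\mathbb{R}$ if there is an (open) neighborhood $U$ of $\lambda$ such that $f$ satisfies the $(g,S)$-Malgrange condition over $U$.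 For a neighborhood $U$ of $\lambda$, ''$f|_{f^{-1}(U)}$ is a trivial fibration'' means that there is a $C^\infty$ diffeomorphism $\Psi:f^{-1}(U)\to f^{-1}(\lambda)\times U$ whose second component is $f$ (the fibre may be empty). *)

(* Defs.v *)
From HB Require Import structures.
From mathcomp Require Import all_boot all_order all_algebra.
From mathcomp Require Import all_classical all_reals all_analysis.

Set Implicit Arguments.
Unset Strict Implicit.
Unset Printing Implicit Defensive.

Import Order.TTheory GRing.Theory Num.Theory.
Import numFieldNormedType.Exports.

Local Open Scope classical_set_scope.
Local Open Scope ring_scope.

Section Euclidean.
Context {R : realType} {n : nat}.
Implicit Types (x y : 'rV[R]_n) (f g : 'rV[R]_n -> R).

Definition dotv x y : R := \sum_i x 0 i * y 0 i.

(* The library norm `|x| on 'rV[R]_n is the sup norm; it induces the same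
   topology, but it is not the Euclidean norm. *)
Definition enorm x : R := Num.sqrt (dotv x x).

Definition gradient f x : 'rV[R]_n := \row_i 'D_(delta_mx 0 i) f x.

Definition regular_value f (l : R) : Prop :=
  forall x, f x = l -> gradient f x != 0.

(* Only meaningful where gradient g x != 0. *)
Definition rel_gradient g f x : 'rV[R]_n :=
  gradient f x
  - (dotv (gradient f x) (gradient g x) / enorm (gradient g x) ^+ 2)
      *: gradient g x.

Definition malgrange_dom f (U : set R) (r : R) : set 'rV[R]_n :=
  f @^-1` U `\` [set x | enorm x <= r].

Definition malgrange_over g (S : set R) f (U : set R) : Prop :=
  exists2 r : R, 0 < r &
    [/\ forall x, malgrange_dom f U r x -> gradient g x != 0,
        malgrange_dom f U r `<=` g @^-1` S
      & forall s, S s -> exists2 delta : R, 0 < delta &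
          forall x, malgrange_dom f U r x -> g x = s ->
            delta <= enorm (rel_gradient g f x) * enorm x].

Definition malgrange_at g (S : set R) f (l : R) : Prop :=
  exists2 U : set R, open_nbhs l U & malgrange_over g S f U.

End Euclidean.

Section Smoothness.
Context {R : realType}.

(* f is C^k at every point of the open set O: f is C^(k+1) iff it is
   differentiable and its differential is C^k.  The spaces used below are
   finite-dimensional, where the latter means that x |-> 'd f x v = 'D_v f x
   is C^k for every v.  Only meaningful for open O. *)
Fixpoint Ck {V W : normedModType R} (k : nat) (O : set V) (f : V -> W)
    {struct k} : Prop :=
  if k is k'.+1 then
    (forall x, O x -> differentiable f x) /\ (forall v, Ck k' O ('D_v f))
  else forall x, O x -> {for x, continuous f}.

Context {V W : normedModType R}.

Definition smooth (O : set V) (f : V -> W) : Prop := forall k, Ck k O f.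

(* Smoothness on an arbitrary subset A of V: near each point of A, f agrees on A
   with a C^oo function defined on an open set of V.  If A is open this is the
   usual notion, and if A is an embedded submanifold it is smoothness for the
   induced manifold structure. *)
Definition smooth_on (A : set V) (f : V -> W) : Prop :=
  forall x, A x -> exists (O : set V) (F : V -> W),
    [/\ open_nbhs x O, smooth O F
      & forall y, A y -> O y -> f y = F y].

End Smoothness.

Definition diffeomorphism {R : realType} {V W : normedModType R}
    (A : set V) (B : set W) (Psi : V -> W) : Prop :=
  smooth_on A Psi /\ exists Phi : W -> V,
    [/\ smooth_on B Phi,
        forall x, A x -> B (Psi x) /\ Phi (Psi x) = x
      & forall y, B y -> A (Phi y) /\ Psi (Phi y) = y].

(* When l is a regular value of f, the fibre of f over l is an embedded
   submanifold, so smoothness on the subset f @^-1` [set l] `*` U of R^n x R is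
   smoothness on the product manifold. *)
Definition trivial_fibration {R : realType} {n : nat}
    (f : 'rV[R]_n -> R) (l : R) (U : set R) : Prop :=
  exists Psi : 'rV[R]_n -> 'rV[R]_n * R,
    diffeomorphism (f @^-1` U) (f @^-1` [set l] `*` U) Psi /\
    forall x, U (f x) -> (Psi x).2 = f x.

(* Main.v *)
Require Import Defs.
From HB Require Import structures.
From mathcomp Require Import all_boot all_order all_algebra.
From mathcomp Require Import all_classical all_reals all_analysis.
From mathcomp Require Import ring lra.

(* Let rho be a bump function equal to 1 near lambda.  Outside a large ball the
   field w = |grad g|^2 grad f - <grad f, grad g> grad g is orthogonal to grad g,
   and inside it grad f does not vanish on the fibres near lambda; a smooth
   partition of unity gives u equal to grad f inside and to w outside, with
   <u, grad f> > 0 near the fibre, and v = rho(f) u / <u, grad f> satisfies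
   df(v) = rho(f).  The field v is complete: a trajectory exploding in finite
   time would eventually leave the ball for good, hence stay on a fibre
   g = s, where |v| <= |x| / delta_s allows only exponential growth.  Moving
   x along the flow phi of v for the time lambda - f(x) trivializes f.
   Smoothness of phi follows by induction on the order of differentiability:
   the flow of (x, xi) |-> (v(x), Dv(x) xi) is the tangent map of phi. *)

(** The constants delta_s may tend to 0 as s varies, so condition (3) gives no bound on the field
    that is uniform outside the ball; orthogonality to grad g is what makes each single delta_s
    usable. A trajectory may still cross the ball's boundary repeatedly and change its value of g in
    between; a cutoff h of |x|^2, whose derivative along the field is bounded, limits such crossings
    near the explosion time. The field w is |grad g|^2 times the projected gradient, a form without
    division that is smooth also where grad g vanishes. Since <w, grad f> = |grad g|^2 |grad_g f|^2,
    the normalized field w / <w, grad f> has norm 1 / |grad_g f|; this is the origin of the bound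
    |x| / delta_s. The factor rho(f) makes the field global and smooth, as it vanishes wherever the
    denominator might. Row vectors carry the sup norm, which is not differentiable, so Gronwall
    estimates for curves run on [dotv x x] and pay factors of the dimension. *)

Set Implicit Arguments.
Unset Strict Implicit.
Unset Printing Implicit Defensive.

Import Order.TTheory GRing.Theory Num.Theory.
Import numFieldNormedType.Exports.

Local Open Scope classical_set_scope.
Local Open Scope ring_scope.

(** * Calculus of C^k maps *)

Section CkTheory.
Context {R : realType}.
Implicit Types V W : normedModType R.

Lemma Ck_continuous V W k (O : set V) (f : V -> W) :
  Ck k O f -> forall x, O x -> {for x, continuous f}.
Proof.
case: k => [//|k [df _] x Ox].
by apply: differentiable_continuous; exact: df.
Qed.

Lemma CkW V W k (O : set V) (f : V -> W) : Ck k.+1 O f -> Ck k O f.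
Proof.
elim: k f => [f|k IHk f [df Df]]; first exact: Ck_continuous.
by split=> // v; apply: IHk; exact: Df.
Qed.

Lemma Ck_subset V W k (O A : set V) (f : V -> W) :
  A `<=` O -> Ck k O f -> Ck k A f.
Proof.
move=> AO; elim: k f => [f cf x /AO|k IHk f [df Df]]; first exact: cf.
by split=> [x /AO|v]; [exact: df|exact/IHk/Df].
Qed.

(** The differential of [f] gives a first-order expansion of [g] too, and [diff_unique] identifies
    it with that of [g]. *)
Lemma near_eq_differentiable V W (f g : V -> W) (x : V) :
  (\near x, f x = g x) -> differentiable f x -> differentiable g x.
Proof.
move=> fg df; have fgx := nbhs_singleton fg.
have gE : g \o shift x = cst (g x) + 'd f x +o_ 0 id.
  apply/eqaddoP => e e0.
  have fg0 : \forall h \near 0, f (h + x) = g (h + x).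
    by move: fg; rewrite (near_shift 0)/=; apply: filterS => h /=; rewrite subr0.
  have /eqaddoP/(_ e e0) := diff_locally df.
  by apply: filterS2 fg0 => h fgh /=; rewrite !fctE /= -fgx -fgh.
have dg := diff_unique (diff_continuous df) gE.
by apply/diff_locallyP; rewrite dg; split => //; exact: diff_continuous.
Qed.

(** Derivatives depend only on germs. This allows different formulas on overlapping open sets, as
    for the cut-off coefficient of the field, and lets [Ck_eq] replace a derivative by its computed
    form. *)
Lemma Ck_local V W k (O : set V) (f : V -> W) :
  (forall x, O x -> exists (A : set V) (g : V -> W),
     [/\ open_nbhs x A, Ck k A g & forall y, A y -> f y = g y]) ->
  Ck k O f.
Proof.
elim: k f => [f H x Ox|k IHk f H].
  have [A [g [Ax gC fg]]] := H x Ox.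
  have gx := gC x Ax.2.
  have fgn : \near x, g x = f x.
    by apply: filterS (open_nbhs_nbhs Ax) => y /fg.
  rewrite /prop_for /continuous_at (fg _ Ax.2); apply: cvg_trans gx.
  exact: near_eq_cvg.
split=> [x Ox|v].
  have [A [g [Ax [dg _] fg]]] := H x Ox.
  apply: near_eq_differentiable (dg _ Ax.2).
  by apply: filterS (open_nbhs_nbhs Ax) => y /fg.
apply: IHk => x /H[A [g [Ax [_ Dg] fg]]].
exists A, ('D_v g); split; [exact: Ax|exact: Dg|move=> y Ay].
by apply: near_eq_derive; apply: filterS fg _; exact: open_nbhs_nbhs (conj Ax.1 Ay).
Qed.

Lemma Ck_eq V W k (O : set V) (f g : V -> W) :
  open O -> (forall x, O x -> f x = g x) -> Ck k O g -> Ck k O f.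
Proof. by move=> oO fg Cg; apply: Ck_local => x Ox; exists O, g. Qed.

Lemma Ck_cst V W k (O : set V) (a : W) : Ck k O (cst a).
Proof.
elim: k a => [a x _|k IHk a]; first exact: cst_continuous.
split=> [x _|v]; first exact: differentiable_cst.
by rewrite (_ : 'D_v _ = cst 0)//; apply/funext => x; exact: derive_cst.
Qed.

Lemma Ck_linear_comp V W W' k (O : set V) (L : {linear W -> W'}) (f : V -> W) :
  continuous L -> Ck k O f -> open O -> Ck k O (L \o f).
Proof.
move=> cL + oO; elim: k f => [f Cf x Ox|k IHk f [df Df]].
  by apply: continuous_comp; [exact: Cf|exact: cL].
have dL y : differentiable L y by exact: linear_differentiable.
split=> [x Ox|v]; first by apply: differentiable_comp => //; exact: df.
apply: Ck_eq (IHk _ (Df v)) => // x Ox /=.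
rewrite deriveE; last by apply: differentiable_comp => //; exact: df.
by rewrite diff_comp//=; [rewrite diff_lin// deriveE//; exact: df|exact: df].
Qed.

Lemma Ck_linear V W k (L : {linear V -> W}) :
  continuous L -> Ck k setT L.
Proof.
move=> cL; case: k => [x _|k]; first exact: cL.
split=> [x _|v]; first exact: linear_differentiable.
rewrite (_ : 'D_v L = cst (L v)); first exact: Ck_cst.
by apply/funext => x; rewrite deriveE ?diff_lin//; exact: linear_differentiable.
Qed.

Lemma Ck_add V W k (O : set V) (f g : V -> W) :
  open O -> Ck k O f -> Ck k O g -> Ck k O (fun x => f x + g x).
Proof.
move=> oO; elim: k f g => [f g Cf Cg x Ox|k IHk f g [df Df] [dg Dg]].
  by apply: cvgD; [exact: Cf|exact: Cg].
split=> [x Ox|v]; first by apply: differentiableD; [exact: df|exact: dg].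
apply: Ck_eq (IHk _ _ (Df v) (Dg v)) => // x Ox.
by rewrite -[LHS]/('D_v (f + g) x) deriveD//; apply: diff_derivable;
  [exact: df|exact: dg].
Qed.

Lemma Ck_sum V W k (O : set V) (I : Type) (r : seq I) (F : I -> V -> W) :
  open O -> (forall i, Ck k O (F i)) -> Ck k O (fun x => \sum_(i <- r) F i x).
Proof.
move=> oO CF; elim: r => [|i r IHr].
  by apply: Ck_eq (Ck_cst k O 0) => // x _; rewrite big_nil.
by apply: Ck_eq (Ck_add oO (CF i) IHr) => // x _; rewrite big_cons.
Qed.

Lemma Ck_mul V k (O : set V) (f g : V -> R) :
  open O -> Ck k O f -> Ck k O g -> Ck k O (fun x => f x * g x).
Proof.
move=> oO; elim: k f g => [f g Cf Cg x Ox|k IHk f g Cf Cg].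
  by apply: cvgM; [exact: Cf|exact: Cg].
have [[df Df] [dg Dg]] := (Cf, Cg).
split=> [x Ox|v]; first by apply: differentiableM; [exact: df|exact: dg].
apply: Ck_eq (Ck_add oO (IHk _ _ (CkW Cf) (Dg v))
                        (IHk _ _ (CkW Cg) (Df v))) => // x Ox.
by rewrite -[LHS]/('D_v (f * g) x) deriveM//; apply: diff_derivable;
  [exact: df|exact: dg].
Qed.

Lemma Ck_scale V W k (O : set V) (a : R) (f : V -> W) :
  open O -> Ck k O f -> Ck k O (fun x => a *: f x).
Proof.
move=> oO Cf.
apply: (Ck_linear_comp (L := ( *:%R a : {linear W -> W}))) => //.
exact: scaler_continuous.
Qed.

Lemma Ck_sub V W k (O : set V) (f g : V -> W) :
  open O -> Ck k O f -> Ck k O g -> Ck k O (fun x => f x - g x).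
Proof.
move=> oO Cf Cg; apply: (Ck_eq oO _ (Ck_add oO Cf (Ck_scale (-1) oO Cg))) => x _.
by rewrite scaleN1r.
Qed.

(** The derivative - f^-2 Df contains 1/f again, and the induction hypothesis controls it one order
    lower. *)
Lemma Ck_inv V k (O : set V) (f : V -> R) :
  open O -> (forall x, O x -> f x != 0) -> Ck k O f ->
  Ck k O (fun x => (f x)^-1).
Proof.
move=> oO f0; elim: k => [Cf x Ox|k IHk Cf].
  by apply: cvgV; [exact: f0|exact: Cf].
have [df Df] := Cf.
split=> [x Ox|v]; first by apply: differentiableV; [exact: df|exact: f0].
have If := IHk (CkW Cf).
apply: Ck_eq (Ck_scale (- 1) oO (Ck_mul oO (Ck_mul oO If If) (Df v))) => // x Ox.
rewrite deriveV ?f0//; last by apply: diff_derivable; exact: df.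
by rewrite scaleN1r -[_ *: _]/(_ * _) mulNr -invfM -expr2.
Qed.

Lemma Ck_fst (V W : normedModType R) k : Ck k setT (fst : V * W -> V).
Proof.
pose L (p : V * W) := p.1.
have lL : linear L by [].
pose LL := GRing.isLinear.Build _ _ _ _ L lL.
pose LT : {linear (V * W)%type -> V} := HB.pack L LL.
by apply: (@Ck_linear _ _ k LT) => p; exact: cvg_fst.
Qed.

Lemma Ck_snd (V W : normedModType R) k : Ck k setT (snd : V * W -> W).
Proof.
pose L (p : V * W) := p.2.
have lL : linear L by [].
pose LL := GRing.isLinear.Build _ _ _ _ L lL.
pose LT : {linear (V * W)%type -> W} := HB.pack L LL.
by apply: (@Ck_linear _ _ k LT) => p; exact: cvg_snd.
Qed.

Lemma Ck_coord V k (O : set V) m (f : V -> 'rV[R]_m) i :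
  open O -> Ck k O f -> Ck k O (fun x => f x 0 i).
Proof.
move=> oO Cf.
pose L (u : 'rV[R]_m) := u 0 i.
have lL : linear L by move=> a u w; rewrite /L !mxE.
pose LL := GRing.isLinear.Build _ _ _ _ L lL.
pose LT : {linear 'rV[R]_m -> R} := HB.pack L LL.
by apply: (@Ck_linear_comp _ _ _ k O LT f) => //; exact: coord_continuous.
Qed.

Lemma Ck_scalel V W k (O : set V) (a : V -> R) (w : W) :
  open O -> Ck k O a -> Ck k O (fun x => a x *: w).
Proof.
move=> oO Ca.
pose L (u : R) : W := u *: w.
have lL : linear L by move=> b u u'; rewrite /L scalerDl scalerA.
pose LL := GRing.isLinear.Build _ _ _ _ L lL.
pose LT : {linear R -> W} := HB.pack L LL.
apply: (@Ck_linear_comp _ _ _ k O LT a) => //.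
exact: scalel_continuous.
Qed.

Lemma Ck_rV V k (O : set V) m (f : V -> 'rV[R]_m) :
  open O -> (forall i, Ck k O (fun x => f x 0 i)) -> Ck k O f.
Proof.
move=> oO Cf.
apply: (@Ck_eq _ _ k O f (fun x => \sum_i f x 0 i *: delta_mx 0 i)) => //.
  by move=> x _; exact: row_sum_delta.
by apply: Ck_sum => // i; exact: Ck_scalel.
Qed.

Lemma Ck_id V k : Ck k setT (@idfun V).
Proof. by apply: (@Ck_linear _ _ k idfun) => x; exact: cvg_id. Qed.

Lemma linear_continuous_rV m W (L : {linear 'rV[R]_m -> W}) : continuous L.
Proof.
have LE : (L : _ -> _) = fun u : 'rV[R]_m => \sum_i u 0 i *: L (delta_mx 0 i).
  apply/funext => u; rewrite {1}(row_sum_delta u) linear_sum.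
  by apply: eq_bigr => i _; rewrite linearZ.
move=> u; have : Ck 0 setT (L : _ -> _).
  rewrite LE; apply: Ck_sum; first exact: openT.
  by move=> i; apply: Ck_scalel; [exact: openT|exact: (Ck_coord i openT (Ck_id _ 0))].
by move=> /(_ u I).
Qed.

Lemma Ck_row_mx V k (O : set V) m p (f : V -> 'rV[R]_m) (g : V -> 'rV[R]_p) :
  open O -> Ck k O f -> Ck k O g -> Ck k O (fun x => row_mx (f x) (g x)).
Proof.
move=> oO Cf Cg; apply: Ck_rV => // i.
rewrite [X in Ck _ _ X](_ : _ = fun x : V =>
    match fintype.split i with inl j => f x 0 j | inr j => g x 0 j end).
  by case: (fintype.split i) => j; exact: Ck_coord.
by apply/funext => x; rewrite mxE.
Qed.

Lemma Ck_lsubmx V k (O : set V) m p (f : V -> 'rV[R]_(m + p)) :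
  open O -> Ck k O f -> Ck k O (fun x => lsubmx (f x)).
Proof.
move=> oO Cf; apply: Ck_rV => // i.
rewrite (_ : (fun x => _) = fun x => f x 0 (lshift p i)); first exact: Ck_coord.
by apply/funext => x; rewrite mxE.
Qed.

Lemma Ck_rsubmx V k (O : set V) m p (f : V -> 'rV[R]_(m + p)) :
  open O -> Ck k O f -> Ck k O (fun x => rsubmx (f x)).
Proof.
move=> oO Cf; apply: Ck_rV => // i.
rewrite (_ : (fun x => _) = fun x => f x 0 (rshift m i)); first exact: Ck_coord.
by apply/funext => x; rewrite mxE.
Qed.

Lemma diff_rVE m W (f : 'rV[R]_m -> W) x u : differentiable f x ->
  'D_u f x = \sum_i u 0 i *: 'D_(delta_mx 0 i) f x.
Proof.
move=> df; rewrite deriveE// {1}(row_sum_delta u) linear_sum.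
by apply: eq_bigr => i _; rewrite linearZ deriveE.
Qed.

(** By the chain rule in coordinates, D_v (f o g) is a finite sum of products of coordinates of D_v
    g with partial derivatives of [f] composed with [g], to which the induction hypothesis applies.
    Hence the row vectors as intermediate space. *)
Lemma Ck_comp V k (O : set V) m (A : set 'rV[R]_m)
    (f : 'rV[R]_m -> R) (g : V -> 'rV[R]_m) :
  open O -> (forall x, O x -> A (g x)) ->
  Ck k A f -> Ck k O g -> Ck k O (f \o g).
Proof.
move=> oO gO; elim: k f => [f Cf Cg x Ox|k IHk f [df Df] Cg].
  by apply: continuous_comp; [exact: Cg|exact/Cf/gO].
have [dg Dg] := Cg.
split=> [x Ox|v].
  by apply: differentiable_comp; [exact: dg|exact/df/gO].
have step i : Ck k O (fun x => 'D_v g x 0 i * ('D_(delta_mx 0 i) f \o g) x).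
  apply: Ck_mul => //; first exact: (Ck_coord i oO (Dg v)).
  exact: IHk (Df _) (CkW Cg).
apply: (Ck_eq oO _ (Ck_sum _ oO step)) => x Ox.
have dfx := df _ (gO _ Ox); have dgx := dg _ Ox.
rewrite deriveE; last exact: differentiable_comp.
rewrite diff_comp//= -(deriveE v dgx) -deriveE//.
exact: diff_rVE.
Qed.

Lemma Ck_comp_rV V k (O : set V) m p (A : set 'rV[R]_m)
    (f : 'rV[R]_m -> 'rV[R]_p) (g : V -> 'rV[R]_m) :
  open O -> open A -> (forall x, O x -> A (g x)) ->
  Ck k A f -> Ck k O g -> Ck k O (f \o g).
Proof.
move=> oO oA gO Cf Cg; apply: Ck_rV => // i.
exact: (Ck_comp (f := fun x => f x 0 i) oO gO (Ck_coord i oA Cf) Cg).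
Qed.

Lemma Ck_comp1 V k (O : set V) (f : R -> R) (g : V -> R) :
  open O -> Ck k setT f -> Ck k O g -> Ck k O (f \o g).
Proof.
move=> oO; elim: k f => [f Cf Cg x Ox|k IHk f [df Df] Cg].
  by apply: continuous_comp; [exact: Cg|exact/Cf].
have [dg Dg] := Cg.
split=> [x Ox|v].
  by apply: differentiable_comp; [exact: dg|exact/df].
apply: (Ck_eq oO _ (Ck_mul oO (Dg v) (IHk _ (Df 1) (CkW Cg)))) => x Ox.
have dfx := df (g x) I; have dgx := dg _ Ox.
rewrite deriveE; last exact: differentiable_comp.
rewrite diff_comp//= -(deriveE v dgx) (deriveE _ dfx).
by rewrite -[X in 'd f (g x) X = _]mulr1 -[_ * 1]/(_ *: 1) linearZ.
Qed.

Lemma Ck_pair V W W' k (O : set V) (f : V -> W) (g : V -> W') :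
  open O -> Ck k O f -> Ck k O g -> Ck k O (fun x => (f x, g x)).
Proof.
move=> oO; elim: k f g => [f g Cf Cg x Ox|k IHk f g [df Df] [dg Dg]].
  by apply: cvg_pair; [exact: Cf|exact: Cg].
split=> [x Ox|v]; first by apply: differentiable_pair; [exact: df|exact: dg].
apply: Ck_eq (IHk _ _ (Df v) (Dg v)) => // x Ox.
rewrite deriveE; last by apply: differentiable_pair; [exact: df|exact: dg].
by rewrite diff_pair ?(deriveE _ (df _ Ox)) ?(deriveE _ (dg _ Ox))//;
  [exact: df|exact: dg].
Qed.

(** A quadratic remainder is little-o of the increment. This criterion serves where the derivative
    is found by an estimate: for flows in the initial point, and for [flat] at 0. *)
Lemma quadratic_differentiable V W (f : V -> W) (L : {linear V -> W}) (x : V) r C :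
  continuous L -> 0 < r ->
  (forall h, `|h| <= r -> `|f (x + h) - f x - L h| <= C * `|h| ^+ 2) ->
  differentiable f x /\ forall h, 'D_h f x = L h.
Proof.
move=> cL r0 fL.
have fE : f \o shift x = cst (f x) + (L : V -> W) +o_ 0 id.
  apply/eqaddoP => e e0.
  have C1 : 0 < `|C| + 1 by rewrite ltr_wpDl.
  have d0 : 0 < Num.min r (e / (`|C| + 1)) by rewrite lt_min r0 divr_gt0.
  apply: filterS (nbhsx_ballx (0 : V) _ d0) => h.
  rewrite -ball_normE /= sub0r normrN lt_min => /andP[/ltW hr /ltW he].
  rewrite !fctE /= opprD addrA [h + x]addrC (le_trans (fL _ hr))//.
  rewrite expr2 mulrA ler_wpM2r//.
  rewrite (le_trans (_ : _ <= (`|C| + 1) * `|h|))//.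
    by rewrite ler_wpM2r// (le_trans (ler_norm _))// lerDl.
  by rewrite mulrC -ler_pdivlMr.
have dE := diff_unique cL fE.
have df : differentiable f x by apply/diff_locallyP; rewrite dE.
by split => // h; rewrite deriveE// dE.
Qed.

Lemma smooth_smooth_on V W (A : set V) (f : V -> W) : smooth setT f -> smooth_on A f.
Proof.
by move=> sf x _; exists setT, f; split => //; split => //; exact: openT.
Qed.

End CkTheory.

(** * Differential inequalities and primitives *)

Section RealVariable.
Context {R : realType}.
Implicit Types (a b t s : R).

Lemma is_derive_within_continuous (h dh : R -> R) a b :
  (forall t, a <= t <= b -> is_derive t 1 h (dh t)) ->
  {within `[a, b], continuous h}.
Proof.
move=> dhP; apply: continuous_in_subspaceT => t.
rewrite inE/= in_itv/= => /dhP[hd _].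
exact/differentiable_continuous/derivable1_diffP.
Qed.

Lemma derive_le0_le (h dh : R -> R) a b : a <= b ->
  (forall t, a <= t <= b -> is_derive t 1 h (dh t) /\ dh t <= 0) ->
  h b <= h a.
Proof.
move=> ab H; have Hd t : a <= t <= b -> is_derive t 1 h (dh t) by move=> /H[].
have [t||c /[!in_itv]/= /H[_ c0]] := @MVT_segment R h dh a b ab.
- by rewrite in_itv/= => /andP[at_ tb]; apply: Hd; rewrite !ltW.
- exact: is_derive_within_continuous Hd.
- move=> E; rewrite -subr_le0 E.
  by rewrite mulr_le0_ge0 ?subr_ge0.
Qed.

Lemma is_derive_comp1 (W : normedModType R) (f : R -> W) (x : R -> R) t df dx :
  is_derive (x t) 1 f df -> is_derive t 1 x dx ->
  is_derive t 1 (fun s => f (x s)) (dx *: df).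
Proof.
move=> fd xd.
have /derivable1_diffP dF := @ex_derive _ _ _ _ _ _ _ fd.
have /derivable1_diffP dX := @ex_derive _ _ _ _ _ _ _ xd.
have dc : differentiable (f \o x) t by exact: differentiable_comp.
apply: DeriveDef; first exact/derivable1_diffP.
rewrite -[LHS]/('D_1 (f \o x) t) deriveE// diff_comp//= -(deriveE (1 : R) dX).
rewrite (@derive_val _ _ _ _ _ _ _ xd) -[X in 'd _ _ X]mulr1 -[_ * 1]/(_ *: 1).
by rewrite linearZ /= -deriveE// (@derive_val _ _ _ _ _ _ _ fd).
Qed.

Lemma is_derive_reverse (W : normedModType R) (h : R -> W) (d : W) t :
  is_derive (- t) 1 h d -> is_derive t 1 (fun s => h (- s)) (- d).
Proof.
by move=> hd; rewrite -scaleN1r; apply: is_derive_comp1; exact: is_deriveNid.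
Qed.

Lemma is_derive_mulr a t : is_derive t 1 (fun s => s * a) a.
Proof.
apply: (is_derive_eq (is_deriveM (is_derive_id t 1) (is_derive_cst a t 1))).
by rewrite scaler0 add0r /= -[_ *: _]/(_ * _) mulr1.
Qed.

Lemma is_derive_mull a t : is_derive t 1 (fun s => a * s) a.
Proof.
by apply: (is_derive_eq (is_deriveZ a (is_derive_id t 1))); rewrite [LHS]mulr1.
Qed.

Lemma is_derive_expRM a t : is_derive t 1 (fun s => expR (a * s)) (a * expR (a * t)).
Proof.
exact: (@is_derive_comp1 _ expR (fun s => a * s) t _ _
  (is_derive_expR _) (is_derive_mull a t)).
Qed.

(** The function u(s) e^(-as) - bs is nonincreasing: the term b e^(-as) left by the hypothesis is at
    most b because a and s are nonnegative. *)
Lemma gronwall (u du : R -> R) a b T : 0 <= T -> 0 <= a -> 0 <= b ->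
  (forall t, 0 <= t <= T -> is_derive t 1 u (du t)) ->
  (forall t, 0 <= t <= T -> du t <= a * u t + b) ->
  u T <= (u 0 + b * T) * expR (a * T).
Proof.
move=> T0 a0 b0 dU leU.
pose w s := u s * expR (- a * s) - b * s.
have : w T <= w 0.
  apply: (@derive_le0_le _ (fun s => (du s - a * u s) * expR (- a * s) - b)) => //.
  move=> t t0T; split.
    have ud := dU _ t0T; have ed := is_derive_expRM (- a) t.
    have bd := is_derive_mull b t.
    apply: (is_derive_eq (is_deriveB (is_deriveM ud ed) bd)).
    by rewrite -![_ *: _]/(_ * _); ring.
  have e1 : expR (- a * t) <= 1.
    by rewrite expR_le1 mulNr oppr_le0 mulr_ge0//; case/andP: t0T.
  have := leU _ t0T; rewrite -lerBlDl => dua.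
  rewrite subr_le0; apply: le_trans (_ : b * expR (- a * t) <= _).
    by rewrite ler_wpM2r ?expR_ge0.
  by rewrite ler_piMr.
rewrite /w !mulr0 expR0 mulr1 subr0 lerBlDr mulNr expRN.
by rewrite ler_pdivrMr ?expR_gt0.
Qed.

(** The weight e^(a|t|) reproduces itself under integration with a gain of 1/a, and this gain makes
    the Picard iterates converge on the whole line. The comparison with C e^(at) for t >= 0 is
    applied to y and -y, then to the reversed curve. *)
Lemma derive_bound_expR (y dy : R -> R) a C T : 0 <= C -> y 0 = 0 ->
  (forall t, is_derive t 1 y (dy t)) ->
  (forall t, `|dy t| <= a * C * expR (a * `|t|)) ->
  `|y T| <= C * expR (a * `|T|).
Proof.
move=> C0.
have half (z dz : R -> R) t : 0 <= t -> z 0 = 0 ->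
    (forall t, is_derive t 1 z (dz t)) ->
    (forall t, `|dz t| <= a * C * expR (a * `|t|)) -> z t <= C * expR (a * `|t|).
  move=> t0 z0 dZ leZ.
  have : z t - C * expR (a * t) <= z 0 - C * expR (a * 0).
    apply: (@derive_le0_le (fun s => z s - C * expR (a * s))
       (fun s => dz s - C * (a * expR (a * s)))) => // s /andP[s0 st]; split.
      have zd := dZ s; have ed := is_derive_expRM a s.
      exact: (is_deriveB zd (is_deriveZ C ed)).
    rewrite subr_le0 (le_trans (ler_norm _))// (le_trans (leZ _))//.
    by rewrite (ger0_norm s0) mulrCA mulrA.
  rewrite z0 mulr0 expR0 ger0_norm// => h.
  by have := h; lra.
move=> y0 dY leY.
have halfabs t (z dz : R -> R) : 0 <= t -> z 0 = 0 ->
    (forall t, is_derive t 1 z (dz t)) ->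
    (forall t, `|dz t| <= a * C * expR (a * `|t|)) -> `|z t| <= C * expR (a * `|t|).
  move=> t0 z0 dZ leZ; rewrite ler_norml (half z dz)// andbT lerNl.
  apply: (half (fun s => - z s) (fun s => - dz s)) => //.
  - by rewrite z0 oppr0.
  - by move=> s; rewrite normrN.
have [T0|/ltW T0] := leP 0 T; first exact: (halfabs T y dy).
rewrite -[T]opprK normrN.
apply: (halfabs (- T) (fun s => y (- s)) (fun s => - dy (- s))).
- by rewrite oppr_ge0.
- by rewrite oppr0.
- by move=> t; exact: is_derive_reverse.
- by move=> t; rewrite normrN -(normrN t).
Qed.

(* The primitives on the half-lines [-N, +oo[ are glued. *)
Lemma continuous_primitive (h : R -> R) : continuous h ->
  exists H : R -> R, H 0 = 0 /\ forall t, is_derive t 1 H (h t).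
Proof.
move=> ch.
have loc (N : nat) : exists HN : R -> R, forall t, - N%:R < t -> is_derive t 1 HN (h t).
  exists (fun t => \int[lebesgue_measure]_(s in [set` `[- N%:R, t]]) h s)%R.
  move=> t Nt.
  have tt1 : t < t + 1 by rewrite ltrDl.
  have ih : lebesgue_measure.-integrable `[- N%:R, t + 1] (EFin \o h).
    apply: continuous_compact_integrable; first exact: segment_compact.
    exact: continuous_subspaceT.
  have [dH HE] := continuous_FTC1_closed tt1 ih Nt (ch t).
  by apply: DeriveDef; [exact: dH|rewrite -HE derive1E].
have {loc} [HN HNP] := choice loc.
have HNM N M t : - N%:R < t -> - M%:R < t -> - N%:R < 0 :> R -> - M%:R < 0 :> R ->
    HN N t - HN N 0 = HN M t - HN M 0.
  move=> Nt Mt N0 M0.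
  pose D s := HN N s - HN M s.
  have dD s : - N%:R < s -> - M%:R < s -> is_derive s 1 D 0.
    move=> Ns Ms; have dN := HNP _ _ Ns; have dM := HNP _ _ Ms.
    by apply: (is_derive_eq (is_deriveB dN dM)); rewrite subrr.
  suff: D t = D 0 by rewrite /D; lra.
  have mono x y : x <= y -> - N%:R < x -> - M%:R < x -> D x = D y.
    move=> xy Nx Mx; apply/eqP; rewrite eq_le.
    have d0 s : x <= s <= y -> is_derive s 1 D 0.
      by move=> /andP[xs _]; apply: dD; [apply: lt_le_trans xs|apply: lt_le_trans xs].
    apply/andP; split; last first.
      by apply: (@derive_le0_le _ (cst 0)) => // s /d0.
    rewrite -lerN2; apply: (@derive_le0_le (- D) (cst 0)) => // s /d0 ds; split => //.
    by apply: (is_derive_eq (is_deriveN ds)); rewrite oppr0.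
  by have [t0|/ltW t0] := leP 0 t; [apply/esym|]; apply: mono.
pose N t := (Num.trunc `|t|).+1.
pose H t := HN (N t) t - HN (N t) 0.
have HE t : 0 < (N t)%:R :> R /\ `|t| < (N t)%:R.
  by split; rewrite ?ltr0n//; exact: truncnS_gt.
exists H; split; first by rewrite /H subrr.
move=> t; have [Nt0 tNt] := HE t.
have [M Nt1M] : exists M : nat, `|t| + 1 < M%:R.
  by exists (Num.trunc (`|t| + 1)).+1; exact: truncnS_gt.
have M0 : - M%:R < 0 :> R by rewrite oppr_lt0; apply: le_lt_trans Nt1M; rewrite addr_ge0.
have nE : \near t, HN M t - HN M 0 = H t.
  near=> s; apply: HNM => //.
  - rewrite ltrNl; apply: le_lt_trans (ler_norm _) _; rewrite normrN.
    apply: le_lt_trans Nt1M; rewrite -[s](subrK t) addrC.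
    apply: le_trans (ler_normD _ _) _; rewrite lerD2l.
    near: s; apply: filterS (nbhsx_ballx t 1 ltr01) => s.
    by rewrite -ball_normE /= distrC => /ltW.
  - by have [_ ?] := HE s; rewrite ltrNl (le_lt_trans (ler_norm _))// normrN.
  - by have [? _] := HE s; rewrite oppr_lt0.
apply: near_eq_is_derive nE _.
have dM : is_derive t 1 (HN M) (h t).
  apply: HNP; rewrite ltrNl (le_lt_trans (ler_norm _))// normrN.
  by apply: lt_trans Nt1M; rewrite ltrDl.
by apply: (is_derive_eq (is_deriveB dM (is_derive_cst (HN M 0) t 1))); rewrite subr0.
Unshelve. all: by end_near. Qed.

(* The limit is the supremum of the left ends of the nested intervals
   [u k - 2 A / 2^k, u k + 2 A / 2^k]. *)
Lemma geometric_cauchy_limit (u : nat -> R) (A : R) :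
  (forall k, `|u k.+1 - u k| <= A / 2 ^+ k) ->
  exists l, forall k, `|l - u k| <= 2 * A / 2 ^+ k.
Proof.
move=> uA.
pose c k := 2 * A / 2 ^+ k.
have cS k : c k.+1 + A / 2 ^+ k = c k.
  by rewrite /c exprS invfM; field.
have c0 k : 0 <= c k.
  have : 0 <= A by have := le_trans (normr_ge0 _) (uA 0%N); rewrite expr0 divr1.
  by move=> A0; rewrite /c divr_ge0 ?mulr_ge0 ?exprn_ge0.
have lo k j : u k - c k <= u (k + j)%N - c (k + j)%N.
  elim: j => [|j IHj]; first by rewrite addn0.
  apply: le_trans IHj _; rewrite addnS.
  by have := uA (k + j)%N; rewrite ler_norml => /andP[? ?]; have := cS (k + j)%N; lra.
have hi k j : u (k + j)%N + c (k + j)%N <= u k + c k.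
  elim: j => [|j IHj]; first by rewrite addn0.
  apply: le_trans IHj; rewrite addnS.
  by have := uA (k + j)%N; rewrite ler_norml => /andP[? ?]; have := cS (k + j)%N; lra.
have lohi k j : u k - c k <= u j + c j.
  have := lo k j; have := hi j k; rewrite addnC => ? ?.
  by have := c0 (k + j)%N; lra.
pose E := [set u k - c k | k in [set: nat]].
have Esup : has_sup E.
  by split; [exists (u 0%N - c 0%N); exists 0%N|exists (u 0%N + c 0%N) => _ [k _ <-]].
exists (sup E) => k; rewrite ler_distl; apply/andP; split.
  by apply: ub_le_sup; [case: Esup|exists k].
apply: ge_sup; first by case: Esup.
by move=> _ [j _ <-].
Qed.

Lemma le_geometric_eps (x y A : R) :
  (forall k, x <= y + A / 2 ^+ k) -> x <= y.
Proof.
move=> H; apply/ler_addgt0Pr => e e0.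
have [A0|A0] := leP A 0.
  have := H 0%N; rewrite expr0 divr1; lra.
(* With this index, A / e < k + 1 < 2^(k+1). *)
pose k := Num.trunc (A / e).
apply: le_trans (H k.+1) _; rewrite lerD2l ler_pdivrMr ?exprn_gt0//.
rewrite mulrC -ler_pdivrMr//; apply: le_trans (ltW (truncnS_gt _)) _.
by rewrite -natrX ler_nat ltnW// ltn_expl.
Qed.

End RealVariable.

(** * Row vectors and the Euclidean product *)

Section RowVectors.
Context {R : realType}.
Implicit Types (t s T : R) (m : nat).

Lemma norm_rV_le m (x : 'rV[R]_m) c :
  0 <= c -> (forall i, `|x 0 i| <= c) -> `|x| <= c.
Proof.
move=> c0 xc; rewrite [leLHS]/Num.Def.normr/= mx_normrE; apply: bigmax_le => // -[i j] _ /=.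
by rewrite (ord1 i).
Qed.

Lemma coord_le_norm m (x : 'rV[R]_m) i : `|x 0 i| <= `|x|.
Proof.
rewrite [leRHS]/Num.Def.normr/= mx_normrE.
exact: (le_bigmax _ (fun ij : 'I_1 * 'I_m => `|x ij.1 ij.2|) (0, i)).
Qed.

Lemma is_derive_rV (V : normedModType R) m (M : V -> 'rV[R]_m) (x v : V) D :
  is_derive x v M D <-> forall i, is_derive x v (fun y => M y 0 i) (D 0 i).
Proof.
split=> [[dM <-] i|H].
  by apply: DeriveDef; [exact: (derivable_mxP M x v).1|rewrite derive_mx// mxE].
have dM : derivable M x v.
  by apply/derivable_mxP => i j; rewrite (ord1 i); exact: (@ex_derive _ _ _ _ _ _ _ (H j)).
apply: DeriveDef => //; rewrite derive_mx//; apply/rowP => j; rewrite mxE.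
exact: (@derive_val _ _ _ _ _ _ _ (H j)).
Qed.

Lemma dotvC m (x y : 'rV[R]_m) : dotv x y = dotv y x.
Proof. by apply: eq_bigr => i _; rewrite mulrC. Qed.

Lemma dotvDr m (x y z : 'rV[R]_m) : dotv x (y + z) = dotv x y + dotv x z.
Proof. by rewrite -big_split; apply: eq_bigr => i _; rewrite mxE mulrDr. Qed.

Lemma dotvZr m a (x y : 'rV[R]_m) : dotv x (a *: y) = a * dotv x y.
Proof. by rewrite mulr_sumr; apply: eq_bigr => i _; rewrite mxE mulrCA. Qed.

Lemma dotvDl m (x y z : 'rV[R]_m) : dotv (x + y) z = dotv x z + dotv y z.
Proof. by rewrite dotvC dotvDr !(dotvC z). Qed.

Lemma dotvZl m a (x y : 'rV[R]_m) : dotv (a *: x) y = a * dotv x y.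
Proof. by rewrite dotvC dotvZr dotvC. Qed.

Lemma dotv_ge0 m (x : 'rV[R]_m) : 0 <= dotv x x.
Proof. by apply: sumr_ge0 => i _; rewrite -expr2 sqr_ge0. Qed.

Lemma sqr_norm_le_dotv m (x : 'rV[R]_m) : `|x| ^+ 2 <= dotv x x.
Proof.
have [->|x0] := eqVneq `|x| 0; first by rewrite expr0n dotv_ge0.
have [i xi] := mx_norm_neq0 x0; rewrite [`|x|]xi.
rewrite (ord1 i.1) real_normK ?num_real// /dotv (bigD1 i.2)//= -expr2 lerDl.
by apply: sumr_ge0 => j _; rewrite -expr2 sqr_ge0.
Qed.

(** From t <= 1 + t^2, which gives a bound without square roots. *)
Lemma norm_le_dotv m (x : 'rV[R]_m) B : dotv x x <= B -> `|x| <= 1 + B.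
Proof.
by move=> xB; have := sqr_norm_le_dotv x; have := normr_ge0 x; nra.
Qed.

(** There are m products of coordinates, each bounded by the product of the sup norms; the dimension
    factors in the later estimates originate here. *)
Lemma norm_dotv_le m (x y : 'rV[R]_m) : `|dotv x y| <= m%:R * (`|x| * `|y|).
Proof.
rewrite (le_trans (ler_norm_sum _ _ _))//.
rewrite (_ : m%:R = \sum_(i < m) 1 :> R); last by rewrite sumr_const card_ord.
rewrite mulr_suml ler_sum// => i _.
by rewrite mul1r normrM ler_pM ?coord_le_norm.
Qed.

Lemma is_derive_dotv (V : normedModType R) m (f g : V -> 'rV[R]_m) x v df dg :
  is_derive x v f df -> is_derive x v g dg ->
  is_derive x v (fun y => dotv (f y) (g y)) (dotv df (g x) + dotv (f x) dg).
Proof.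
move=> /is_derive_rV fd /is_derive_rV gd.
have := is_derive_sum (fun i => is_deriveM (fd i) (gd i)).
rewrite (_ : \sum_(i < m) _ = fun y => dotv (f y) (g y)); last first.
  by apply/funext => y; rewrite fct_sumE.
move=> H; apply: (is_derive_eq H).
rewrite /dotv -big_split; apply: eq_bigr => i _.
by rewrite -![_ *: _]/(_ * _) addrC mulrC.
Qed.

(** Gronwall is applied to u = [dotv x x]. Since 2 |x| (K |x| + c) <= (2 K + 1) |x|^2 + c^2, the
    rate and the source term are m (2 K + 1) and m c^2. *)
Lemma norm_gronwall_pos m (x dx : R -> 'rV[R]_m) K c T :
  0 <= T -> 0 <= K -> 0 <= c ->
  (forall t, 0 <= t <= T -> is_derive t 1 x (dx t)) ->
  (forall t, 0 <= t <= T -> `|dx t| <= K * `|x t| + c) ->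
  `|x T| ^+ 2 <= (m%:R * `|x 0| ^+ 2 + m%:R * c ^+ 2 * T)
                 * expR ((2 * K + 1) * m%:R * T).
Proof.
move=> T0 K0 c0 dX leX.
apply: le_trans (sqr_norm_le_dotv _) _.
pose u t := dotv (x t) (x t).
pose du t := dotv (dx t) (x t) + dotv (x t) (dx t).
have := @gronwall R u du ((2 * K + 1) * m%:R) (m%:R * c ^+ 2) T T0.
have m0 : 0 <= m%:R :> R by [].
move=> /(_ _ _ _ _)/le_trans; apply.
- by rewrite mulr_ge0// addr_ge0// mulr_ge0.
- by rewrite mulr_ge0// sqr_ge0.
- by move=> t /dX xd; exact: is_derive_dotv.
- move=> t /leX xl; rewrite /du dotvC -mulr2n.
  have h1 := le_trans (ler_norm _) (norm_dotv_le (x t) (dx t)).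
  have h2 := sqr_norm_le_dotv (x t).
  have n0 := normr_ge0 (x t).
  have h3 : `|x t| * `|dx t| <= `|x t| * (K * `|x t| + c) by rewrite ler_wpM2l.
  have h4 : (2 * K + 1) * `|x t| ^+ 2 <= (2 * K + 1) * u t.
    by rewrite ler_wpM2l// addr_ge0// mulr_ge0.
  have h5 : 2 * (`|x t| * `|dx t|) <= (2 * K + 1) * u t + c ^+ 2.
    by have := sqr_ge0 (`|x t| - c); nra.
  have h6 : m%:R * (2 * (`|x t| * `|dx t|)) <= m%:R * ((2 * K + 1) * u t + c ^+ 2).
    by rewrite ler_wpM2l.
  rewrite mulr2n; move: h1 h6; lra.
- rewrite ler_wpM2r ?expR_ge0// lerD2r.
  by have := norm_dotv_le (x 0) (x 0); rewrite -expr2; exact/le_trans/ler_norm.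
Qed.

Lemma norm_gronwall m (x dx : R -> 'rV[R]_m) K c T :
  0 <= K -> 0 <= c ->
  (forall t, `|t| <= `|T| -> is_derive t 1 x (dx t)) ->
  (forall t, `|t| <= `|T| -> `|dx t| <= K * `|x t| + c) ->
  `|x T| ^+ 2 <= (m%:R * `|x 0| ^+ 2 + m%:R * c ^+ 2 * `|T|)
                 * expR ((2 * K + 1) * m%:R * `|T|).
Proof.
move=> K0 c0 dX leX.
have [T0|/ltW T0] := leP 0 T.
  rewrite (ger0_norm T0); apply: (@norm_gronwall_pos m x dx) => // t /andP[t0 tT].
    by apply: dX; rewrite !ger0_norm// (le_trans t0).
  by apply: leX; rewrite !ger0_norm// (le_trans t0).
rewrite (ler0_norm T0) -{1}[T]opprK -{1}[0 : R]oppr0.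
apply: (@norm_gronwall_pos m (fun t => x (- t)) (fun t => - dx (- t))) => //.
- by rewrite oppr_ge0.
- move=> t /andP[t0 tT]; apply: is_derive_reverse; apply: dX.
  by rewrite normrN ger0_norm// ler0_norm.
- move=> t /andP[t0 tT]; rewrite normrN; apply: leX.
  by rewrite normrN ger0_norm// ler0_norm.
Qed.

Lemma norm_gronwall_eq0 m (x dx : R -> 'rV[R]_m) K T :
  0 <= K -> x 0 = 0 ->
  (forall t, `|t| <= `|T| -> is_derive t 1 x (dx t)) ->
  (forall t, `|t| <= `|T| -> `|dx t| <= K * `|x t|) -> x T = 0.
Proof.
move=> K0 x0 dX leX.
have leX' t : `|t| <= `|T| -> `|dx t| <= K * `|x t| + 0 by rewrite addr0; exact: leX.
have := norm_gronwall K0 (lexx 0) dX leX'.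
rewrite x0 normr0 expr0n !mulr0 mul0r addr0 mul0r => h.
by apply/normr0_eq0/eqP; rewrite -sqrf_eq0 eq_le h sqr_ge0.
Qed.

End RowVectors.

(** * Picard iteration *)

Definition locally_lipschitz {R : realType} {m} (v : 'rV[R]_m -> 'rV[R]_m) :=
  forall B, exists2 K, 0 <= K & forall x y, `|x| <= B -> `|y| <= B ->
    `|v x - v y| <= K * `|x - y|.

Lemma lipschitz_continuous_at {R : realType} (V W : normedModType R) (f : V -> W) K x :
  (forall y, `|f x - f y| <= K * `|x - y|) -> {for x, continuous f}.
Proof.
move=> fK; apply/cvgrPdist_le => e e0.
have K1 : 0 < `|K| + 1 by rewrite ltr_wpDl.
have eK : 0 < e / (`|K| + 1) by rewrite divr_gt0.
apply: filterS (nbhsx_ballx x _ eK) => y; rewrite -ball_normE /= => xy.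
apply: le_trans (fK y) _; apply: le_trans (_ : (`|K| + 1) * `|x - y| <= _).
  by rewrite ler_wpM2r// (le_trans (ler_norm _))// lerDl.
by rewrite mulrC -ler_pdivlMr// ltW.
Qed.

Section Picard.
Context {R : realType} {m : nat}.
Implicit Types (t s T : R) (x y : R -> 'rV[R]_m).

Lemma is_derive_continuous (W : normedModType R) (x : R -> W) t d :
  is_derive t 1 x d -> {for t, continuous x}.
Proof. by move=> [xd _]; exact/differentiable_continuous/derivable1_diffP. Qed.

Lemma continuous_rV (h : R -> 'rV[R]_m) t :
  {for t, continuous h} -> forall i, {for t, continuous (fun s => h s 0 i)}.
Proof.
move=> ch i; apply: (@continuous_comp _ _ _ h (fun u : 'rV[R]_m => u 0 i)) => //.
exact: coord_continuous.
Qed.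

Lemma continuous_primitive_rV (h : R -> 'rV[R]_m) (x0 : 'rV[R]_m) :
  continuous h ->
  exists H : R -> 'rV[R]_m, H 0 = x0 /\ forall t, is_derive t 1 H (h t).
Proof.
move=> ch.
have hi i := continuous_primitive (fun t => @continuous_rV h t (ch t) i).
have {hi} [H HP] := choice hi.
exists (fun t => \row_i (x0 0 i + H i t)); split.
  by apply/rowP => i; rewrite mxE (HP i).1 addr0.
move=> t; apply/is_derive_rV => i.
rewrite [X in is_derive _ _ X _](_ : _ = cst (x0 0 i) + H i); last first.
  by apply/funext => s; rewrite mxE.
have Hd := (HP i).2 t.
by apply: (is_derive_eq (is_deriveD (is_derive_cst (x0 0 i) t 1) Hd)); rewrite add0r.
Qed.

Lemma norm_expR_bound (y dy : R -> 'rV[R]_m) a C t : 0 <= C -> y 0 = 0 ->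
  (forall t, is_derive t 1 y (dy t)) ->
  (forall t, `|dy t| <= a * C * expR (a * `|t|)) ->
  `|y t| <= C * expR (a * `|t|).
Proof.
move=> C0 y0 dY leY; apply: norm_rV_le => [|i]; first by rewrite mulr_ge0 ?expR_ge0.
apply: (@derive_bound_expR _ (fun s => y s 0 i) (fun s => dy s 0 i)) => //.
- by rewrite y0 mxE.
- by move=> s; move/is_derive_rV : (dY s); exact.
- by move=> s; exact: le_trans (coord_le_norm _ _) (leY s).
Qed.

Lemma norm_increment_le (y dy : R -> 'rV[R]_m) M t s :
  (forall t, is_derive t 1 y (dy t)) -> (forall t, `|dy t| <= M) ->
  `|y t - y s| <= M * `|t - s|.
Proof.
move=> dY leM.
have M0 : 0 <= M := le_trans (normr_ge0 _) (leM 0).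
wlog st : s t / s <= t => [H|].
  have [|/ltW] := leP s t; first exact: H.
  by rewrite distrC (distrC t); exact: H.
apply: norm_rV_le => [|i]; first by rewrite mulr_ge0.
have dYi (r : R) : is_derive r 1 (fun r => y r 0 i) (dy r 0 i).
  by move/is_derive_rV : (dY r); exact.
have [|c _ E] := @MVT_segment R (fun r => y r 0 i) (fun r => dy r 0 i) s t st.
- by apply: is_derive_within_continuous => r _; exact: dYi.
- rewrite !mxE E normrM ler_wpM2r//.
  exact: le_trans (coord_le_norm _ _) (leM _).
Qed.

(** For a bounded, globally Lipschitz field the iterates converge on the whole line at once: in the
    weight e^(2 K |t|) one iteration halves the distance. The bound M keeps all iterates
    M-Lipschitz, so their limit is continuous and can be fed to the integral operator again. *)
Lemma picard (w : 'rV[R]_m -> 'rV[R]_m) K M (x0 : 'rV[R]_m) :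
  (forall u, `|w u| <= M) -> (forall u u', `|w u - w u'| <= K * `|u - u'|) ->
  exists x, x 0 = x0 /\ forall t, is_derive t 1 x (w (x t)).
Proof.
move=> wM.
wlog K0 : K / 0 < K => [H wK|wK].
  apply: (H (`|K| + 1)); first by rewrite ltr_wpDl.
  move=> x y; apply: le_trans (wK x y) _; rewrite ler_wpM2r//.
  by rewrite (le_trans (ler_norm _))// lerDl.
have M0 : 0 <= M := le_trans (normr_ge0 _) (wM 0).
have cw : continuous w.
  by move=> u; apply: lipschitz_continuous_at (wK u).
(* The integral operator is made total; its value on a discontinuous [y] is arbitrary, and it is
   only applied to continuous curves. *)
have exP y : exists H, continuous y -> H 0 = x0 /\ forall t, is_derive t 1 H (w (y t)).
  have [cy|ncy] := pselect (continuous y); last by exists y => /ncy.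
  have [|H HP] := @continuous_primitive_rV (w \o y) x0; last by exists H.
  by move=> t; apply: continuous_comp; [exact: cy|exact: cw].
have {exP} [P PP] := choice exP.
pose x k := iter k P (cst x0).
have cx k : continuous (x k).
  elim: k => [t|k IHk t]; first exact: cst_continuous.
  exact: (is_derive_continuous ((PP _ IHk).2 t)).
have xS0 k : x k 0 = x0 by case: k => [//|k]; exact: (PP _ (cx k)).1.
have dx k t : is_derive t 1 (x k.+1) (w (x k t)) := (PP _ (cx k)).2 t.
have sub0 (y z : R -> 'rV[R]_m) : y 0 = x0 -> z 0 = x0 -> (y - z) 0 = 0.
  by move=> y0 z0; rewrite -[LHS]/(y 0 - z 0) y0 z0 subrr.
(* This constant makes K * c = M, so that the first increment, whose speed is at most M, fits the
   weighted bound. *)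
pose c := M / K.
have KcM : K * c = M by rewrite mulrC divfK ?gt_eqF.
have c0 : 0 <= c by rewrite divr_ge0// ltW.
have h2k k : 0 < 2 ^+ k :> R by rewrite exprn_gt0.
have leE a t : 0 <= a -> 1 <= expR (a * `|t|).
  by move=> a0; rewrite -expR0 ler_expR mulr_ge0.
have step k t : `|x k.+1 t - x k t| <= c / 2 ^+ k * expR (2 * K * `|t|).
  elim: k t => [|k IHk] t.
    apply: (@norm_expR_bound (x 1%N - x 0%N) (fun t => w (x 0%N t) - 0)) => //.
    - by rewrite expr0 divr1.
    - exact: sub0 (xS0 1%N) (xS0 0%N).
    - move=> s; rewrite subr0 expr0 divr1 -(mulrA 2) KcM.
      rewrite (le_trans (wM _))// -[leLHS]mulr1 ler_pM//.
        by rewrite ler_peMl// ler1n.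
      by rewrite leE// mulr_ge0// ltW.
  apply: (@norm_expR_bound (x k.+2 - x k.+1) (fun t => w (x k.+1 t) - w (x k t))) => //.
  - by rewrite divr_ge0// ltW.
  - exact: sub0 (xS0 k.+2) (xS0 k.+1).
  - move=> s; apply: le_trans (wK _ _) _.
    apply: le_trans (ler_wpM2l (ltW K0) (IHk s)) _.
    have := gt_eqF (h2k k); set p := 2 ^+ k => p0.
    by rewrite exprS le_eqVlt -/p; apply/orP; left; apply/eqP; field; rewrite p0.
pose E t := 2 * c * expR (2 * K * `|t|).
have exX (p : R * 'I_m) : exists l, forall k, `|l - x k p.1 0 p.2| <= E p.1 / 2 ^+ k.
  have [k|l lP] := @geometric_cauchy_limit R (fun k => x k p.1 0 p.2)
      (c * expR (2 * K * `|p.1|)).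
    have := coord_le_norm (x k.+1 p.1 - x k p.1) p.2; rewrite !mxE => /le_trans; apply.
    by rewrite mulrAC; exact: step.
  by exists l => k; rewrite (le_trans (lP k))// /E mulrA.
have {exX} [l lP] := choice exX.
pose X t := \row_i l (t, i) : 'rV[R]_m.
have E0 t : 0 <= E t by apply: mulr_ge0; [exact: mulr_ge0|exact: expR_ge0].
have Xx k t : `|X t - x k t| <= E t / 2 ^+ k.
  apply: norm_rV_le => [|i]; first by rewrite divr_ge0// ltW.
  by rewrite !mxE; exact: (lP (t, i)).
(* Each iterate is M-Lipschitz, and the error E / 2^k of the limit disappears as k grows. *)
have XM t s : `|X t - X s| <= M * `|t - s|.
  apply: (@le_geometric_eps _ _ _ (E t + E s)) => k.
  have -> : X t - X s = (X t - x k t) - (X s - x k s) + (x k t - x k s).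
    by apply/rowP => i; rewrite !mxE; ring.
  apply: le_trans (ler_normD _ _) _; rewrite [leRHS]addrC.
  apply: lerD.
    apply: le_trans (ler_normB _ _) _; rewrite mulrDl.
    by apply: lerD; exact: Xx.
  case: k => [|k]; first by rewrite subrr normr0 mulr_ge0.
  exact: norm_increment_le (dx k) (fun r => wM _).
have cX : continuous X.
  by move=> t; apply: lipschitz_continuous_at (XM t).
have [PX0 dPX] := PP _ cX.
suff PXX t : P X t = X t.
  exists (P X); split => // t; rewrite PXX; exact: dPX.
apply/eqP; rewrite -subr_eq0 -normr_le0.
apply: (@le_geometric_eps _ _ _ (E t + E t)) => k; rewrite add0r.
(* Both [P X] and [X] are within E / 2^k of the next iterate, since [P X] and that iterate integrate
   the field along curves at distance at most E / 2^k. *)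
have -> : P X t - X t = (P X t - x k.+1 t) - (X t - x k.+1 t) by rewrite opprB addrA subrK.
apply: le_trans (ler_normB _ _) _; rewrite mulrDl; apply: lerD.
  rewrite /E mulrAC.
  apply: (@norm_expR_bound (P X - x k.+1) (fun t => w (X t) - w (x k t))) => //.
  - by apply: divr_ge0; [exact: mulr_ge0|exact: ltW].
  - exact: sub0 PX0 (xS0 k.+1).
  - move=> s; apply: le_trans (wK _ _) _.
    apply: le_trans (ler_wpM2l (ltW K0) (Xx k s)) _.
    rewrite /E (mulrAC _ (expR _)) mulrA ler_wpM2r ?expR_ge0//.
    apply: ler_wpM2r; last by rewrite ler_peMl ?ler1n// ltW.
    by apply: divr_ge0; [exact: mulr_ge0|exact: ltW].
apply: le_trans (Xx _ _) _; rewrite ler_wpM2l// lef_pV2 ?posrE//.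
by rewrite exprS ler_peMl ?ler1n// ltW.
Qed.

End Picard.

(** * Complete vector fields *)

Section C1Estimates.
Context {R : realType}.

Lemma is_derive_comp_curve (V W : normedModType R) (f : V -> W) (x : R -> V) t dx :
  differentiable f (x t) -> is_derive t 1 x dx ->
  is_derive t 1 (f \o x) ('D_dx f (x t)).
Proof.
move=> df xd.
have /derivable1_diffP dX := @ex_derive _ _ _ _ _ _ _ xd.
have dc : differentiable (f \o x) t by exact: differentiable_comp.
apply: DeriveDef; first exact/derivable1_diffP.
by rewrite deriveE// diff_comp//= -(deriveE (1 : R) dX) (@derive_val _ _ _ _ _ _ _ xd) deriveE.
Qed.

Lemma is_derive_line (V : normedModType R) (x d : V) (s : R) :
  is_derive s 1 (fun s => x + s *: d) d.
Proof.
have ds : is_derive s 1 (fun s : R => s *: d) d.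
  have dl : differentiable (fun s : R => s *: d) s by exact: differentiableZl.
  apply: DeriveDef; first exact/derivable1_diffP.
  by rewrite deriveE// diffZl//= diff_val scale1r.
by apply: (is_derive_eq (is_deriveD (is_derive_cst x s 1) ds)); rewrite add0r.
Qed.

Lemma continuous_bounded_ball m (f : 'rV[R]_m -> R) B : continuous f ->
  exists2 K, 0 <= K & forall u, `|u| <= B -> `|f u| <= K.
Proof.
move=> cf; have [B0|B0] := ltP B 0.
  by exists 0 => // u uB; have := le_lt_trans uB B0; rewrite normr_lt0.
pose A := [set u : 'rV[R]_m | `|u| <= B].
have A0 : A !=set0 by exists 0; rewrite /A/= normr0.
have cA : compact A.
  apply: bounded_closed_compact.
    exists B; split; first exact: num_real.
    by move=> M BM u /= uB; rewrite (le_trans uB)// ltW.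
  rewrite (_ : A = (fun u : 'rV[R]_m => `|u|) @^-1` [set r | r <= B])//.
  by apply: closed_comp => [u _|]; [exact: norm_continuous|exact: closed_le].
have cnf : {within A, continuous (fun u => `|f u|)}.
  apply: continuous_subspaceT => u.
  by apply: continuous_comp; [exact: cf|exact: norm_continuous].
have [c cA' cmax] := EVT_max_rV A0 cA cnf.
by exists `|f c| => // u uB; apply: cmax; rewrite inE.
Qed.

Lemma segment_norm_le (V : normedModType R) (x d : V) s B : 0 <= s <= 1 ->
  `|x| <= B -> `|x + d| <= B -> `|x + s *: d| <= B.
Proof.
move=> /andP[s0 s1] xB dB.
have -> : x + s *: d = (1 - s) *: x + s *: (x + d).
  by rewrite scalerDr addrA -scalerDl subrK scale1r.
apply: le_trans (ler_normD _ _) _; rewrite !normrZ !ger0_norm ?subr_ge0//.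
have s1' : 0 <= 1 - s by rewrite subr_ge0.
have := ler_wpM2l s1' xB; have := ler_wpM2l s0 dB; lra.
Qed.

(** The mean value theorem is used on the segment, which stays in the ball by convexity; the
    constant is the sum of bounds of the partial derivatives on that compact ball. *)
Lemma C1_locally_lipschitz_real m (f : 'rV[R]_m -> R) B : Ck 1 setT f ->
  exists2 K, 0 <= K & forall x y, `|x| <= B -> `|y| <= B ->
    `|f x - f y| <= K * `|x - y|.
Proof.
move=> [df Df].
have bnd i : exists K, 0 <= K /\ forall u, `|u| <= B -> `|'D_(delta_mx 0 i) f u| <= K.
  have [|K K0 KP] := @continuous_bounded_ball m ('D_(delta_mx 0 i) f) B.
    by move=> u; exact: (Df (delta_mx 0 i) u I).
  by exists K.
have {bnd} [K KP] := choice bnd.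
exists (\sum_i K i); first by apply: sumr_ge0 => i _; case: (KP i).
move=> x y xB yB; rewrite distrC [leLHS]distrC.
pose z (s : R) := x + s *: (y - x).
have dz (s : R) : is_derive s 1 (f \o z) ('D_(y - x) f (z s)).
  by apply: is_derive_comp_curve; [exact: df|exact: is_derive_line].
have [|s s01] := @MVT_segment R (f \o z) (fun s => 'D_(y - x) f (z s)) 0 1 ler01.
  by apply: is_derive_within_continuous => s _; exact: dz.
rewrite /= /z scale1r scale0r addr0 [x + (y - x)]addrC subrK subr0 mulr1 => ->.
rewrite diff_rVE; last exact: df.
rewrite mulr_suml (le_trans (ler_norm_sum _ _ _))// ler_sum// => i _.
rewrite normrZ mulrC ler_pM//; last exact: coord_le_norm.
apply: (KP i).2; apply: segment_norm_le => //.
by rewrite addrC subrK.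
Qed.

(** The mean value theorem for s |-> f (x + s d) - s D_d f x leaves a difference of first
    derivatives at points at most |d| apart; their Lipschitz bound gives the second factor |d|. *)
Lemma C2_taylor_real m (f : 'rV[R]_m -> R) B : Ck 2 setT f ->
  exists2 K, 0 <= K & forall x d, `|x| <= B -> `|x + d| <= B ->
    `|f (x + d) - f x - 'D_d f x| <= K * `|d| ^+ 2.
Proof.
move=> [df Df].
have lip i : exists K, 0 <= K /\ forall u w, `|u| <= B -> `|w| <= B ->
    `|'D_(delta_mx 0 i) f u - 'D_(delta_mx 0 i) f w| <= K * `|u - w|.
  have [K K0 KP] := C1_locally_lipschitz_real B (Df (delta_mx 0 i)).
  by exists K.
have {lip} [K KP] := choice lip.
exists (\sum_i K i); first by apply: sumr_ge0 => i _; case: (KP i).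
move=> x d xB dB.
pose z (s : R) := x + s *: d.
pose h (s : R) := (f \o z) s - s * 'D_d f x.
have dh (s : R) : is_derive s 1 h ('D_d f (z s) - 'D_d f x).
  have d1 : is_derive s 1 (f \o z) ('D_d f (z s)).
    by apply: is_derive_comp_curve; [exact: df|exact: is_derive_line].
  exact: is_deriveB d1 (is_derive_mulr _ s).
have [|s s01] := @MVT_segment R h (fun s => 'D_d f (z s) - 'D_d f x) 0 1 ler01.
  by apply: is_derive_within_continuous => s _; exact: dh.
rewrite /h /= /z scale1r scale0r addr0 mul0r mul1r subr0 subr0 mulr1 addrAC => ->.
rewrite !diff_rVE; try exact: df.
rewrite -sumrB mulr_suml (le_trans (ler_norm_sum _ _ _))// ler_sum// => i _.
rewrite in_itv/= in s01.
rewrite -scalerBr normrZ expr2 mulrCA ler_pM ?coord_le_norm//.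
apply: le_trans ((KP i).2 _ _ _ _) _ => //; first exact: segment_norm_le.
rewrite addrC addKr normrZ ler_wpM2l//; first exact: (KP i).1.
case/andP: s01 => s0 s1; by rewrite ger0_norm// ler_piMl.
Qed.

Lemma C1_locally_lipschitz m (v : 'rV[R]_m -> 'rV[R]_m) :
  Ck 1 setT v -> locally_lipschitz v.
Proof.
move=> Cv B.
have lip i : exists K, 0 <= K /\ forall u w, `|u| <= B -> `|w| <= B ->
    `|v u 0 i - v w 0 i| <= K * `|u - w|.
  have [K K0 KP] := C1_locally_lipschitz_real B (Ck_coord i openT Cv).
  by exists K.
have {lip} [K KP] := choice lip.
have K0 : 0 <= \sum_i K i by apply: sumr_ge0 => i _; case: (KP i).
exists (\sum_i K i) => // x y xB yB; apply: norm_rV_le => [|i]; first exact: mulr_ge0.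
rewrite !mxE; apply: le_trans ((KP i).2 _ _ xB yB) _; rewrite ler_wpM2r//.
by rewrite (bigD1 i)//= lerDl sumr_ge0// => j _; case: (KP j).
Qed.

Lemma C2_taylor m (v : 'rV[R]_m -> 'rV[R]_m) B : Ck 2 setT v ->
  exists2 K, 0 <= K & forall x d, `|x| <= B -> `|x + d| <= B ->
    `|v (x + d) - v x - 'D_d v x| <= K * `|d| ^+ 2.
Proof.
move=> Cv.
have lip i : exists K, 0 <= K /\ forall x d, `|x| <= B -> `|x + d| <= B ->
    `|v (x + d) 0 i - v x 0 i - 'D_d (fun x => v x 0 i) x| <= K * `|d| ^+ 2.
  have [K K0 KP] := C2_taylor_real B (Ck_coord i openT Cv).
  by exists K.
have {lip} [K KP] := choice lip.
have K0 : 0 <= \sum_i K i by apply: sumr_ge0 => i _; case: (KP i).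
exists (\sum_i K i) => // x d xB dB.
apply: norm_rV_le => [|i]; first by rewrite mulr_ge0// sqr_ge0.
have dv : derivable v x d by apply: diff_derivable; exact: Cv.1.
rewrite derive_mx// !mxE; apply: le_trans ((KP i).2 _ _ xB dB) _.
rewrite ler_wpM2r ?sqr_ge0//.
by rewrite (bigD1 i)//= lerDl sumr_ge0// => j _; case: (KP j).
Qed.

End C1Estimates.

(** * Global solutions by truncation of the field *)

Section GlobalSolutions.
Context {R : realType} {m : nat}.
Implicit Types (t s T : R) (x y : R -> 'rV[R]_m) (v w : 'rV[R]_m -> 'rV[R]_m).

(** Composing a locally Lipschitz field with this retraction onto the sup-norm ball makes it bounded
    and globally Lipschitz without changing it on the ball. *)
Definition clamp (N : R) (u : 'rV[R]_m) : 'rV[R]_m :=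
  \row_i Num.max (- N) (Num.min N (u 0 i)).

Lemma norm_clamp_le N u : 0 <= N -> `|clamp N u| <= N.
Proof.
move=> N0; apply: norm_rV_le => // i; rewrite mxE ler_norml le_max lexx/=.
by rewrite ge_max ge_min lexx andbT (le_trans _ N0)// oppr_le0.
Qed.

Lemma clamp_id N u : `|u| <= N -> clamp N u = u.
Proof.
move=> uN; apply/rowP => i; rewrite mxE.
have := le_trans (coord_le_norm u i) uN; rewrite ler_norml => /andP[h1 h2].
by rewrite min_r// max_r.
Qed.

Lemma clamp_lipschitz N u u' : `|clamp N u - clamp N u'| <= `|u - u'|.
Proof.
apply: norm_rV_le => // i; rewrite !mxE.
have := coord_le_norm (u - u') i; rewrite !mxE; set a := u 0 i; set b := u' 0 i.
rewrite !ler_norml => /andP[h1 h2].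
by rewrite /Num.max /Num.min; do ![case: ifPn => //]; rewrite -?leNgt; move=> *; lra.
Qed.

Lemma clamp_picard v (N : R) (x0 : 'rV[R]_m) : 0 <= N -> locally_lipschitz v ->
  exists x, x 0 = x0 /\ forall t, is_derive t 1 x (v (clamp N (x t))).
Proof.
move=> N0 /(_ N)[K K0 KP].
have cN u := norm_clamp_le u N0.
apply: (@picard _ _ (v \o clamp N) K (`|v 0| + K * N)) => [u|u u'] /=.
  rewrite -[v _](subrK (v 0)) addrC (le_trans (ler_normD _ _))// lerD2l.
  by rewrite (le_trans (KP _ _ _ _)) ?normr0// subr0 ler_wpM2l.
by rewrite (le_trans (KP _ _ _ _))// ler_wpM2l// clamp_lipschitz.
Qed.

Lemma curve_bounded x T : (forall t, `|t| <= T -> {for t, continuous x}) ->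
  exists B, forall t, `|t| <= T -> `|x t| <= B.
Proof.
move=> cx; have [T0|T0] := ltP T 0.
  by exists 0 => t tT; have := le_lt_trans tT T0; rewrite normr_lt0.
have [||c _ cmax] := @EVT_max R (fun t => `|x t|) (- T) T.
- by rewrite lerNl (le_trans _ T0)// oppr_le0.
- apply: continuous_in_subspaceT => t; rewrite inE/= in_itv/= -ler_norml => tT.
  apply: (@continuous_comp _ _ _ x (fun u => `|u|)); first exact: cx.
  exact: norm_continuous.
- by exists `|x c| => t tT; apply: cmax; rewrite in_itv/= -ler_norml.
Qed.

Lemma ode_unique v x y T : locally_lipschitz v ->
  (forall t, `|t| <= `|T| -> is_derive t 1 x (v (x t))) ->
  (forall t, `|t| <= `|T| -> is_derive t 1 y (v (y t))) ->
  x 0 = y 0 -> x T = y T.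
Proof.
move=> lv dx dy xy0.
have [Bx BxP] := curve_bounded (fun t tT => is_derive_continuous (dx t tT)).
have [By ByP] := curve_bounded (fun t tT => is_derive_continuous (dy t tT)).
have [K K0 KP] := lv (Num.max Bx By).
apply/subr0_eq.
apply: (@norm_gronwall_eq0 _ _ (x - y) (fun t => v (x t) - v (y t)) K T) => //.
- by rewrite -[LHS]/(x 0 - y 0) xy0 subrr.
- by move=> t tT; exact: is_deriveB (dx t tT) (dy t tT).
- by move=> t tT; apply: KP; rewrite le_max ?BxP ?ByP ?orbT.
Qed.

(** Absence of finite-time explosion, as an a priori bound on whatever solutions exist. The
    intervals are symmetric so that both time directions are treated at once. *)
Definition bounded_solutions v := forall T x, 0 < T ->
  (forall t, `|t| < T -> is_derive t 1 x (v (x t))) ->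
  exists B, forall t, `|t| < T -> `|x t| <= B.

(** The solutions [X N] of the truncated fields exist for all time, and [good N T] says that the
    truncation is not felt up to time T. If the good times had a finite supremum s, the solution
    glued on |t| < s would be bounded, and a larger truncation level would carry it beyond s. *)
Lemma complete_field v : locally_lipschitz v ->
  bounded_solutions v ->
  forall x0 : 'rV[R]_m, exists x, x 0 = x0 /\ forall t, is_derive t 1 x (v (x t)).
Proof.
move=> lv bv x0.
have [X XP] := choice (fun N : nat => clamp_picard x0 (ler0n R N) lv).
have X0 N : X N 0 = x0 := (XP N).1.
have dX N t : is_derive t 1 (X N) (v (clamp N%:R (X N t))) := (XP N).2 t.
pose good N T := forall t, `|t| <= T -> `|X N t| <= N%:R.
have goodW N T T' : T' <= T -> good N T -> good N T'.
  by move=> T'T gT t tT'; apply: gT; exact: le_trans tT' T'T.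
have dgood N T t : good N T -> `|t| <= T -> is_derive t 1 (X N) (v (X N t)).
  by move=> gT tT; have := dX N t; rewrite clamp_id//; exact: gT.
have agree N M T t : good N T -> good M T -> `|t| <= T -> X N t = X M t.
  move=> gN gM tT; apply: (ode_unique lv); last by rewrite !X0.
    by move=> s st; apply: dgood gN _; exact: le_trans st tT.
  by move=> s st; apply: dgood gM _; exact: le_trans st tT.
have Xlip N : exists2 M, 0 <= M & forall t s, `|X N t - X N s| <= M * `|t - s|.
  have [K K0 KP] := lv N%:R.
  have M0 : 0 <= `|v 0| + K * N%:R by rewrite addr_ge0// mulr_ge0.
  exists (`|v 0| + K * N%:R) => // t s; apply: norm_increment_le (dX N) _ => r.
  have cN := norm_clamp_le (X N r) (ler0n R N).
  rewrite -[v _](subrK (v 0)) addrC (le_trans (ler_normD _ _))// lerD2l.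
  by rewrite (le_trans (KP _ _ _ _)) ?normr0// subr0 ler_wpM2l.
have extend N s B : 0 < s -> B < N%:R -> (forall t, `|t| < s -> `|X N t| <= B) ->
    exists2 e, 0 < e & good N (s + e).
  move=> s0 BN XB; have [M M0 MP] := Xlip N.
  have M1 : 0 < 2 * (M + 1) by rewrite mulr_gt0// ltr_wpDl.
  (* The first bound makes s - e nonnegative; the second makes the possible growth 2 e M at most N -
     B. *)
  pose e := Num.min s ((N%:R - B) / (2 * (M + 1))).
  have e0 : 0 < e by rewrite lt_min s0 divr_gt0// subr_gt0.
  have es : e <= s by rewrite ge_min lexx.
  have eB : e * (2 * (M + 1)) <= N%:R - B.
    by rewrite -ler_pdivlMr// ge_min lexx orbT.
  exists e => // t tse.
  (* Rescaling takes |t| <= s + e into |t'| < s and moves no time by more than 2 e. *)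
  pose t' := t * ((s - e) / (s + e)).
  have q0 : 0 <= (s - e) / (s + e) by rewrite divr_ge0 ?subr_ge0// addr_ge0// ltW.
  have se0 : 0 < s + e by rewrite addr_gt0.
  have t's : `|t'| < s.
    rewrite normrM (ger0_norm q0); apply: le_lt_trans (_ : s - e < s).
      by rewrite mulrA ler_pdivrMr// mulrC ler_wpM2l// subr_ge0.
    by rewrite ltrBlDr ltrDl.
  have tt' : `|t - t'| <= 2 * e.
    have -> : t - t' = t * (2 * e / (s + e)).
      by rewrite /t'; field; rewrite gt_eqF.
    rewrite normrM [`|_ / _|]ger0_norm; last by rewrite divr_ge0 ?mulr_ge0// ltW.
    by rewrite mulrA ler_pdivrMr// mulrC ler_wpM2l// mulr_ge0// ltW.
  rewrite -[X N t](subrK (X N t')) addrC (le_trans (ler_normD _ _))//.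
  have := XB _ t's; have := le_trans (MP t t') (ler_wpM2l M0 tt'); nra.
suff goodT T : 0 <= T -> exists N, good N T.
  have /choice[n nP] : forall T, exists N, 0 <= T -> good N T.
    move=> T; have [T0|T0] := leP 0 T; first by have [N] := goodT _ T0; exists N.
    by exists 0%N.
  pose Y t := X (n `|t|) t.
  exists Y; split; first exact: X0.
  move=> t; pose T := `|t| + 1.
  have T0 : 0 <= T by rewrite addr_ge0.
  have tT : `|t| <= T by rewrite lerDl.
  have YE s : `|s| <= T -> X (n T) s = Y s.
    move=> sT; apply: (@agree _ _ `|s|) => //; last exact: nP.
    by apply: goodW sT _; exact: nP.
  have nE : \near t, X (n T) t = Y t.
    apply: filterS (nbhsx_ballx t 1 ltr01) => s; rewrite -ball_normE /= => ts.
    apply: YE; rewrite -[s](subrK t) addrC (le_trans (ler_normD _ _))// lerD2l.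
    by rewrite distrC ltW.
  apply: (near_eq_is_derive nE); rewrite -YE//.
  exact: dgood (nP _ T0) tT.
apply: contraPP => /forallNP nT T0.
pose E := [set S | 0 <= S /\ exists N, good N S].
have ubE : ubound E T.
  move=> S [S0 [N gS]]; rewrite leNgt; apply/negP => TS.
  by apply: (nT N); apply: goodW gS; exact: ltW.
pose N0 := (Num.trunc `|x0|).+1.
have xN0 : `|x0| < N0%:R by exact: truncnS_gt.
have [e0 e00 Ee0] : exists2 e, 0 < e & E e.
  have [M M0 MP] := Xlip N0.
  have M1 : 0 < M + 1 by rewrite ltr_wpDl.
  (* Moving at speed at most M, the solution cannot get from norm |x0| past N0 within this time. *)
  pose e := (N0%:R - `|x0|) / (M + 1).
  have e0 : 0 < e by rewrite divr_gt0// subr_gt0.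
  have eE : e * (M + 1) = N0%:R - `|x0| by rewrite divfK// gt_eqF.
  exists e => //; split; first exact: ltW.
  exists N0 => t te; have := MP t 0; rewrite subr0 X0 => h.
  rewrite -[X _ t](subrK x0) addrC (le_trans (ler_normD _ _))//.
  have := le_trans h (ler_wpM2l M0 te); nra.
have supE : has_sup E by split; [exists e0|exists T].
pose s := sup E.
have s0 : 0 < s by apply: lt_le_trans e00 _; exact: ub_le_sup (supE.2) _ Ee0.
have goods S : 0 <= S -> S < s -> exists N, good N S.
  move=> S0 Ss; have sS : 0 < s - S by rewrite subr_gt0.
  have [S' [S'0 [N gS']]] := sup_adherent sS supE.
  by rewrite subKr => /ltW SS'; exists N; exact: goodW gS'.
have /choice[n nP] : forall S, exists N, 0 <= S -> S < s -> good N S.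
  move=> S; have [[S0 Ss]|H] := pselect (0 <= S /\ S < s).
    by have [N] := goods _ S0 Ss; exists N.
  by exists 0%N => S0 Ss; case: H.
pose Y t := X (n `|t|) t.
have YE S r : 0 <= S -> S < s -> `|r| <= S -> X (n S) r = Y r.
  move=> S0 Ss rS; apply: (@agree _ _ `|r|) => //.
    by apply: goodW rS _; exact: nP.
  by apply: nP => //; exact: le_lt_trans rS Ss.
have dY t : `|t| < s -> is_derive t 1 Y (v (Y t)).
  move=> ts; pose d := (s - `|t|) / 2.
  have d0 : 0 < d by rewrite divr_gt0// subr_gt0.
  pose S := `|t| + d.
  have S0 : 0 <= S by rewrite addr_ge0// ltW.
  have Ss : S < s by rewrite /S /d; move: ts; lra.
  have tS : `|t| <= S by rewrite lerDl ltW.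
  have nE : \near t, X (n S) t = Y t.
    apply: filterS (nbhsx_ballx t d d0) => r; rewrite -ball_normE /= => tr.
    apply: YE => //; rewrite -[r](subrK t) addrC (le_trans (ler_normD _ _))// lerD2l.
    by rewrite distrC ltW.
  apply: (near_eq_is_derive nE); rewrite -(YE S)//.
  by apply: dgood tS; exact: nP.
have [B YB] := bv s Y s0 dY.
pose N := (Num.trunc B).+1.
have BN : B < N%:R by exact: truncnS_gt.
(* Here [X N] is only known to solve the truncated equation. [Y] solves it too, being bounded by B <
   N, so uniqueness is applied to the truncated field. *)
have XN t : `|t| < s -> X N t = Y t.
  move=> ts; have [K K0 KP] := lv N%:R.
  have lvN : locally_lipschitz (v \o clamp N%:R).
    move=> B'; exists K => // u u' _ _ /=.
    by rewrite (le_trans (KP _ _ _ _)) ?norm_clamp_le// ler_wpM2l// clamp_lipschitz.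
  apply: (ode_unique lvN) => [r rt|].
    have rs : `|r| < s := le_lt_trans rt ts.
    by rewrite /= clamp_id; [exact: dY|rewrite (le_trans (YB _ rs))// ltW].
  by rewrite X0 /Y X0.
have [|e ep gse] := extend N s B s0 BN.
  by move=> t ts; rewrite XN//; exact: YB.
have : s + e <= s.
  apply: (ub_le_sup supE.2); split; last by exists N.
  by rewrite addr_ge0// ltW.
by rewrite gerDl leNgt ep.
Qed.

End GlobalSolutions.

(** * Smoothness of flows *)

Section SmoothFlow.
Context {R : realType}.
Implicit Types (m : nat) (t s : R).

Definition is_flow m (v : 'rV[R]_m -> 'rV[R]_m) (phi : 'rV[R]_m -> R -> 'rV[R]_m) :=
  forall x, phi x 0 = x /\ forall t, is_derive t 1 (phi x) (v (phi x t)).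

Lemma smoothW (V W : normedModType R) (O : set V) (f : V -> W) u :
  smooth O f -> smooth O ('D_u f).
Proof. by move=> sf k; exact: (sf k.+1).2 u. Qed.

Lemma smooth_locally_lipschitz m (v : 'rV[R]_m -> 'rV[R]_m) :
  smooth setT v -> locally_lipschitz v.
Proof. by move=> sv; exact: C1_locally_lipschitz (sv 1%N). Qed.

Lemma derive_bounded_ball m (v : 'rV[R]_m -> 'rV[R]_m) B : Ck 1 setT v ->
  exists2 K, 0 <= K & forall u d, `|u| <= B -> `|'D_d v u| <= K * `|d|.
Proof.
move=> [dv Dv].
have bnd i : exists K, 0 <= K /\ forall u, `|u| <= B -> `|'D_(delta_mx 0 i) v u| <= K.
  have [|K K0 KP] := @continuous_bounded_ball R m (fun u => `|'D_(delta_mx 0 i) v u|) B.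
    move=> u; apply: (@continuous_comp _ _ _ ('D_(delta_mx 0 i) v) (fun w => `|w|) u).
      exact: (Dv (delta_mx 0 i) u I).
    exact: norm_continuous.
  by exists K; split=> // u uB; rewrite -[leLHS]normr_id; exact: KP.
have {bnd} [K KP] := choice bnd.
exists (\sum_i K i); first by apply: sumr_ge0 => i _; case: (KP i).
move=> u d uB; rewrite diff_rVE; last exact: dv.
rewrite mulr_suml (le_trans (ler_norm_sum _ _ _))// ler_sum// => i _.
rewrite normrZ mulrC ler_pM//; last exact: coord_le_norm.
exact: (KP i).2.
Qed.

Lemma is_derive_lsubmx m p (z : R -> 'rV[R]_(m + p)) t dz :
  is_derive t 1 z dz -> is_derive t 1 (fun s => lsubmx (z s)) (lsubmx dz).
Proof.
move=> /is_derive_rV dZ; apply/is_derive_rV => i.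
rewrite mxE [X in is_derive _ _ X _](_ : _ = fun s => z s 0 (lshift p i)); first exact: dZ.
by apply/funext => s; rewrite mxE.
Qed.

Lemma is_derive_rsubmx m p (z : R -> 'rV[R]_(m + p)) t dz :
  is_derive t 1 z dz -> is_derive t 1 (fun s => rsubmx (z s)) (rsubmx dz).
Proof.
move=> /is_derive_rV dZ; apply/is_derive_rV => i.
rewrite mxE [X in is_derive _ _ X _](_ : _ = fun s => z s 0 (rshift m i)); first exact: dZ.
by apply/funext => s; rewrite mxE.
Qed.

Lemma is_derive_row_mx m p (x : R -> 'rV[R]_m) (y : R -> 'rV[R]_p) t dx dy :
  is_derive t 1 x dx -> is_derive t 1 y dy ->
  is_derive t 1 (fun s => row_mx (x s) (y s)) (row_mx dx dy).
Proof.
move=> /is_derive_rV dX /is_derive_rV dY; apply/is_derive_rV => i.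
rewrite -[i]splitK; case: (fintype.split i) => j /=.
  rewrite row_mxEl [X in is_derive _ _ X _](_ : _ = fun s => x s 0 j); first exact: dX.
  by apply/funext => s; rewrite row_mxEl.
rewrite row_mxEr [X in is_derive _ _ X _](_ : _ = fun s => y s 0 j); first exact: dY.
by apply/funext => s; rewrite row_mxEr.
Qed.

Lemma norm_row_mx_le m p (x : 'rV[R]_m) (y : 'rV[R]_p) : `|row_mx x y| <= `|x| + `|y|.
Proof.
apply: norm_rV_le => [|i]; first by rewrite addr_ge0.
rewrite -[i]splitK; case: (fintype.split i) => j /=.
  by rewrite row_mxEl (le_trans (coord_le_norm _ _))// lerDl.
by rewrite row_mxEr (le_trans (coord_le_norm _ _))// lerDr.
Qed.

(* The field whose flow is the tangent map of the flow of v. *)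
Definition tangent_field m (v : 'rV[R]_m -> 'rV[R]_m) (z : 'rV[R]_(m + m)) :=
  row_mx (v (lsubmx z)) ('D_(rsubmx z) v (lsubmx z)).

Lemma smooth_tangent_field m (v : 'rV[R]_m -> 'rV[R]_m) :
  smooth setT v -> smooth setT (tangent_field v).
Proof.
move=> sv k.
have cl : Ck k setT (fun z : 'rV[R]_(m + m) => lsubmx z).
  by apply: Ck_lsubmx; [exact: openT|exact: Ck_id].
have Cvl (w : 'rV[R]_m -> 'rV[R]_m) : smooth setT w ->
    Ck k setT (fun z : 'rV[R]_(m + m) => w (lsubmx z)).
  by move=> sw; apply: (Ck_comp_rV openT openT _ (sw k) cl).
apply: Ck_row_mx; [exact: openT|exact: Cvl|].
rewrite (_ : (fun x => _) = fun z : 'rV[R]_(m + m) =>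
    \sum_i rsubmx z 0 i *: 'D_(delta_mx 0 i) v (lsubmx z)); last first.
  by apply/funext => z; rewrite diff_rVE//; exact: (sv 1%N).1.
apply: Ck_sum => [|i]; first exact: openT.
apply: Ck_rV => [|j]; first exact: openT.
rewrite (_ : (fun x => _) = fun z : 'rV[R]_(m + m) =>
    z 0 (rshift m i) * 'D_(delta_mx 0 i) v (lsubmx z) 0 j); last first.
  by apply/funext => z; rewrite !mxE.
apply: Ck_mul; first exact: openT.
  by apply: Ck_coord; [exact: openT|exact: Ck_id].
apply: (@Ck_coord _ _ k setT m (fun z : 'rV[R]_(m + m) => 'D_(delta_mx 0 i) v (lsubmx z))).
  exact: openT.
exact: (Cvl _ (smoothW (delta_mx 0 i) sv)).
Qed.

Lemma flow_unique m (v : 'rV[R]_m -> 'rV[R]_m) phi (y : R -> 'rV[R]_m) T :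
  locally_lipschitz v -> is_flow v phi ->
  (forall t, `|t| <= `|T| -> is_derive t 1 y (v (y t))) -> y T = phi (y 0) T.
Proof.
move=> lv fl dy; have [p0 dp] := fl (y 0).
by apply: (ode_unique lv dy) => //; rewrite p0.
Qed.

(** The base component of a solution follows the complete flow [phi], hence is bounded; the fibre
    component then solves a linear equation with bounded coefficients and is bounded by Gronwall. *)
Lemma tangent_flow m (v : 'rV[R]_m -> 'rV[R]_m) phi :
  smooth setT v -> is_flow v phi -> exists Phi, is_flow (tangent_field v) Phi.
Proof.
move=> sv fl.
suff bT : bounded_solutions (tangent_field v).
  have lT := smooth_locally_lipschitz (smooth_tangent_field sv).
  by have [Phi PhiP] := choice (complete_field lT bT); exists Phi.
move=> T z T0 dz.
pose a t := lsubmx (z t); pose xi t := rsubmx (z t).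
have da t : `|t| < T -> is_derive t 1 a (v (a t)).
  by move=> /dz /is_derive_lsubmx; rewrite /tangent_field row_mxKl.
have dxi t : `|t| < T -> is_derive t 1 xi ('D_(xi t) v (a t)).
  by move=> /dz /is_derive_rsubmx; rewrite /tangent_field row_mxKr.
have lv := smooth_locally_lipschitz sv.
have aE t : `|t| < T -> a t = phi (a 0) t.
  move=> tT; apply: (flow_unique lv fl) => s st; apply: da.
  exact: le_lt_trans st tT.
have [A AP] := @curve_bounded _ _ (phi (a 0)) T
  (fun t _ => is_derive_continuous ((fl (a 0)).2 t)).
have [K K0 KP] := derive_bounded_ball A (sv 1%N).
have aA t : `|t| < T -> `|a t| <= A.
  by move=> tT; rewrite aE// AP// ltW.
pose B := (m%:R * `|xi 0| ^+ 2) * expR ((2 * K + 1) * m%:R * T).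
exists (A + (1 + B)) => t tT.
rewrite -(hsubmxK (z t)) (le_trans (norm_row_mx_le _ _))//.
apply: lerD; first exact: aA.
have : `|xi t| ^+ 2 <= B.
  have := @norm_gronwall R m xi (fun t => 'D_(xi t) v (a t)) K 0 t K0 (lexx 0).
  rewrite expr0n mulr0 mul0r addr0 => /(_ _ _)/le_trans; apply.
  - by move=> s st; apply: dxi; exact: le_lt_trans st tT.
  - by move=> s st; rewrite addr0; apply/KP/aA; exact: le_lt_trans st tT.
  - apply: ler_wpM2l; first by rewrite mulr_ge0// sqr_ge0.
    by rewrite ler_expR ler_wpM2l ?(ltW tT)// mulr_ge0// addr_ge0// mulr_ge0.
rewrite -/(xi t); have := normr_ge0 (xi t); nra.
Qed.

(** Since c <= (1 + c)^2. This turns the squared Gronwall estimates into linear ones. *)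
Lemma sqr_le_affine (a b c : R) : 0 <= a -> 0 <= b -> 0 <= c ->
  a ^+ 2 <= c * b ^+ 2 -> a <= (1 + c) * b.
Proof.
move=> a0 b0 c0 h; rewrite -(@ler_pXn2r _ 2)// ?nnegrE ?mulr_ge0 ?addr_ge0//.
by rewrite (le_trans h)// exprMn ler_wpM2r ?sqr_ge0//; nra.
Qed.

(** If A bounds the central trajectory, the nearby one is replaced by the solution [y] of the field
    truncated at A + 1, for which a Lipschitz constant is available in advance. For |h| <= (1 +
    E)^-1 the deviation is at most 1, so [y] never feels the truncation and is the true
    trajectory. *)
Lemma flow_lipschitz m (v : 'rV[R]_m -> 'rV[R]_m) phi x :
  locally_lipschitz v -> is_flow v phi ->
  exists A C r, [/\ 0 <= C, 0 < r, forall t, `|t| <= 1 -> `|phi x t| <= A &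
    forall h t, `|h| <= r -> `|t| <= 1 ->
      `|phi (x + h) t| <= A /\ `|phi (x + h) t - phi x t| <= C * `|h|].
Proof.
move=> lv fl; have [px0 dpx] := fl x.
have [A AP] := @curve_bounded _ _ (phi x) 1 (fun t _ => is_derive_continuous (dpx t)).
have A0 : 0 <= A by apply: le_trans (AP 0 _) => //; rewrite normr0.
have A1 : 0 <= A + 1 by rewrite addr_ge0.
have [K K0 KP] := lv (A + 1).
pose E := m%:R * expR ((2 * K + 1) * m%:R).
have E0 : 0 <= E by rewrite mulr_ge0// expR_ge0.
have E1 : 0 < 1 + E by rewrite ltr_pwDl.
exists (A + 1), (1 + E), (1 + E)^-1; split => //; first exact: ltW.
- by rewrite invr_gt0.
- by move=> t /AP; move/le_trans; apply; rewrite lerDl.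
move=> h t hr t1.
have [y [y0 dy]] := clamp_picard (x + h) A1 lv.
have yx s : `|s| <= 1 -> `|y s - phi x s| <= (1 + E) * `|h|.
  move=> s1; apply: sqr_le_affine => //.
  have := @norm_gronwall R m (y - phi x)
    (fun t => v (clamp (A + 1) (y t)) - v (phi x t)) K 0 s K0 (lexx 0).
  rewrite expr0n mulr0 mul0r addr0 => /(_ _ _)/le_trans; apply.
  - move=> r rs; rewrite addr0; have r1 := le_trans rs s1.
    have pA : `|phi x r| <= A + 1 by rewrite (le_trans (AP _ r1))// lerDl.
    apply: le_trans (KP _ _ _ _) _ => //; first exact: norm_clamp_le.
    by rewrite ler_wpM2l// -{1}(clamp_id pA) clamp_lipschitz.
  - rewrite [(y - phi x) 0](_ : _ = h); last first.
      by rewrite -[LHS]/(y 0 - phi x 0) y0 px0 addrC addKr.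
    rewrite /E mulrAC ler_wpM2r ?sqr_ge0// ler_wpM2l// ler_expR.
    by rewrite ler_piMr// mulr_ge0// addr_ge0// mulr_ge0.
have hE : (1 + E) * `|h| <= 1 by rewrite mulrC -ler_pdivlMr// div1r.
have yA s : `|s| <= 1 -> `|y s| <= A + 1.
  move=> s1; rewrite -[y s](subrK (phi x s)) addrC (le_trans (ler_normD _ _))//.
  by rewrite lerD ?AP// (le_trans (yx _ s1)).
have -> : phi (x + h) t = y t.
  rewrite -y0; apply/esym; apply: (flow_unique lv fl) => s st.
  by have := dy s; rewrite clamp_id// yA// (le_trans st).
by split; [exact: yA|exact: yx].
Qed.

(** The candidate derivative is the fibre part of the tangent flow, linear by uniqueness. The error
    e = phi (x + h) - phi x - psi h starts at 0 and satisfies e' = Dv(phi x) e + O(|h|^2) by Taylor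
    and [flow_lipschitz]; Gronwall makes it quadratic in |h|. *)
Lemma flow_derive m (v : 'rV[R]_m -> 'rV[R]_m) phi Phi x :
  smooth setT v -> is_flow v phi -> is_flow (tangent_field v) Phi ->
  differentiable (phi ^~ 1) x /\
  forall h, 'D_h (phi ^~ 1) x = rsubmx (Phi (row_mx x h) 1).
Proof.
move=> sv fl Fl; have lv := smooth_locally_lipschitz sv.
have lTv := smooth_locally_lipschitz (smooth_tangent_field sv).
have dv u : differentiable v u by exact: (sv 1%N).1.
pose psi h t := rsubmx (Phi (row_mx x h) t).
have PhiE h t : lsubmx (Phi (row_mx x h) t) = phi x t.
  have [P0 dP] := Fl (row_mx x h).
  have := @flow_unique m v phi (fun t => lsubmx (Phi (row_mx x h) t)) t lv fl.
  rewrite P0 row_mxKl; apply => s _.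
  by have := is_derive_lsubmx (dP s); rewrite /tangent_field row_mxKl.
have psi0 h : psi h 0 = h by rewrite /psi (Fl _).1 row_mxKr.
have dpsi h t : is_derive t 1 (psi h) ('D_(psi h t) v (phi x t)).
  have [_ dP] := Fl (row_mx x h).
  by have := is_derive_rsubmx (dP t); rewrite /tangent_field row_mxKr PhiE.
pose L h := psi h 1.
have lL : linear L.
  move=> a h k.
  pose z t := row_mx (phi x t) (a *: psi h t + psi k t).
  have -> : L (a *: h + k) = rsubmx (z 1).
    rewrite /L /psi; congr rsubmx.
    have -> : row_mx x (a *: h + k) = z 0 by rewrite /z (fl x).1 !psi0.
    apply/esym; apply: (flow_unique lTv Fl) => t _.
    rewrite /tangent_field row_mxKl row_mxKr.
    apply: is_derive_row_mx; first exact: (fl x).2.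
    apply: (is_derive_eq (is_deriveD (is_deriveZ a (dpsi h t)) (dpsi k t))).
    by rewrite !deriveE// linearP.
  by rewrite /z row_mxKr.
pose LL := GRing.isLinear.Build _ _ _ _ L lL.
pose LT : {linear 'rV[R]_m -> 'rV[R]_m} := HB.pack L LL.
have [A [C [r [C0 r0 xA hP]]]] := flow_lipschitz x lv fl.
have [K K0 KP] := derive_bounded_ball A (sv 1%N).
have [M M0 MP] := C2_taylor A (sv 2%N).
pose E := m%:R * (M * C ^+ 2) ^+ 2 * expR ((2 * K + 1) * m%:R).
have E0 : 0 <= E by rewrite mulr_ge0 ?expR_ge0// mulr_ge0// sqr_ge0.
apply: (@quadratic_differentiable _ _ _ (phi ^~ 1) LT x r (1 + E)) => //.
  exact: linear_continuous_rV.
move=> h hr; rewrite -[LT h]/(psi h 1).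
pose e t := phi (x + h) t - phi x t - psi h t.
pose de t := v (phi (x + h) t) - v (phi x t) - 'D_(psi h t) v (phi x t).
have dE t : is_derive t 1 e (de t).
  exact: is_deriveB (is_deriveB ((fl _).2 t) ((fl x).2 t)) (dpsi h t).
have e0 : e 0 = 0 by rewrite /e (fl x).1 (fl _).1 psi0 [x + h]addrC addrK subrr.
rewrite -/(e 1); apply: sqr_le_affine; rewrite ?sqr_ge0//.
have c0 : 0 <= M * (C * `|h|) ^+ 2 by rewrite mulr_ge0// sqr_ge0.
have := @norm_gronwall R m e de K (M * (C * `|h|) ^+ 2) 1 K0 c0.
move=> /(_ _ _)/le_trans; apply.
- rewrite normr1 => t t1; have [pA pC] := hP h t hr t1.
  set d := phi (x + h) t - phi x t.
  have -> : de t = (v (phi x t + d) - v (phi x t) - 'D_d v (phi x t))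
                   + 'D_(e t) v (phi x t).
    have -> : 'D_(e t) v (phi x t) = 'D_d v (phi x t) - 'D_(psi h t) v (phi x t).
      by rewrite !deriveE// -linearB.
    by rewrite addrA subrK /d [phi x t + _]addrC subrK.
  rewrite addrC (le_trans (ler_normD _ _))//; apply: lerD; first exact/KP/xA.
  apply: le_trans (MP _ _ _ _) _; first exact: xA.
    by rewrite /d [phi x t + _]addrC subrK.
  by rewrite ler_wpM2l// lerXn2r// nnegrE// mulr_ge0.
- rewrite e0 normr0 expr0n mulr0 add0r normr1 !mulr1 /E !exprMn.
  rewrite le_eqVlt; apply/orP; left; apply/eqP; ring.
Qed.

(** A derivative in the initial point is a component of the time-1 map of a flow in doubled
    dimension, so the induction quantifies over the dimension, the field and the flow. *)
Lemma flow_time1_Ck k m (v : 'rV[R]_m -> 'rV[R]_m) phi :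
  smooth setT v -> is_flow v phi -> Ck k setT (phi ^~ 1).
Proof.
elim: k m v phi => [|k IHk] m v phi sv fl;
  have [Phi Fl] := tangent_flow sv fl.
  by move=> x _; apply: differentiable_continuous; case: (flow_derive x sv fl Fl).
split=> [x _|h]; first by case: (flow_derive x sv fl Fl).
rewrite (_ : 'D_h _ = fun x => rsubmx (Phi (row_mx x h) 1)); last first.
  by apply/funext => x; case: (flow_derive x sv fl Fl) => _ ->.
have CP := IHk _ _ _ (smooth_tangent_field sv) Fl.
apply: Ck_rsubmx; first exact: openT.
apply: (Ck_comp_rV openT openT _ CP) => //.
by apply: Ck_row_mx; [exact: openT|exact: Ck_id|exact: Ck_cst].
Qed.

(* The time is absorbed in the state: the field (x, t) |-> (t v(x), 0) has flow
   (x, t) |-> (phi x (s t), t) at time s. *)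
Lemma smooth_flow m (v : 'rV[R]_m -> 'rV[R]_m) phi :
  smooth setT v -> is_flow v phi ->
  smooth setT (fun z : 'rV[R]_(m + 1) => phi (lsubmx z) (rsubmx z 0 0)).
Proof.
move=> sv fl k.
pose w (z : 'rV[R]_(m + 1)) : 'rV[R]_(m + 1) := row_mx (rsubmx z 0 0 *: v (lsubmx z)) 0.
pose Phi (z : 'rV[R]_(m + 1)) s := row_mx (phi (lsubmx z) (s * rsubmx z 0 0)) (rsubmx z).
have sw : smooth setT w.
  move=> j; apply: Ck_row_mx; [exact: openT| |exact: Ck_cst].
  have Cl : Ck j setT (fun z : 'rV[R]_(m + 1) => lsubmx z).
    by apply: Ck_lsubmx; [exact: openT|exact: Ck_id].
  have Cr : Ck j setT (fun z : 'rV[R]_(m + 1) => rsubmx z).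
    by apply: Ck_rsubmx; [exact: openT|exact: Ck_id].
  have Cv : Ck j setT (fun z : 'rV[R]_(m + 1) => v (lsubmx z)).
    exact: (Ck_comp_rV openT openT _ (sv j) Cl).
  apply: Ck_rV => [|i]; first exact: openT.
  rewrite (_ : (fun x => _) = fun z : 'rV[R]_(m + 1) =>
    rsubmx z 0 0 * v (lsubmx z) 0 i); last by apply/funext => z; rewrite !mxE.
  by apply: Ck_mul; [exact: openT|exact: Ck_coord openT Cr|exact: Ck_coord openT Cv].
have Fl : is_flow w Phi.
  move=> z; split; first by rewrite /Phi mul0r (fl _).1 hsubmxK.
  move=> s; rewrite /w /Phi row_mxKl row_mxKr; set t := rsubmx z 0 0.
  apply: is_derive_row_mx.
  have dp := (fl (lsubmx z)).2 (s * t).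
  exact: (@is_derive_comp1 _ _ (phi (lsubmx z)) (fun s => s * t) _ _ _ dp (is_derive_mulr t s)).
rewrite (_ : (fun z => _) = fun z => lsubmx (Phi z 1)).
  by apply: Ck_lsubmx; [exact: openT|exact: flow_time1_Ck sw Fl].
by apply/funext => z; rewrite /Phi row_mxKl mul1r.
Qed.

End SmoothFlow.

(** * A smooth step function *)

Section SmoothStep.
Context {R : realType}.
Implicit Types (p q : {poly R}) (x y : R).

Lemma horner_le_expR p : exists2 C, 0 <= C & forall y, 0 <= y -> `|p.[y]| <= C * expR y.
Proof.
exists (\sum_(i < size p) `|p`_i| * i`!%:R).
  by apply: sumr_ge0 => i _; rewrite mulr_ge0.
move=> y y0; rewrite horner_coef mulr_suml (le_trans (ler_norm_sum _ _ _))//.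
apply: ler_sum => i _; rewrite normrM -mulrA ler_wpM2l// ger0_norm ?exprn_ge0//.
case: (i : nat) => [|k]; first by rewrite expr0 fact0 mul1r -expR0 ler_expR.
rewrite mulrC -ler_pdivrMr ?ltr0n ?fact_gt0//.
by apply: le_trans (expR_ge1Dxn k y0); rewrite lerDr.
Qed.

(** This family, extended by 0, is closed under differentiation, so the smoothness of e^(-1/x)
    follows by one induction for all polynomials p. *)
Definition flat p x : R := if 0 < x then p.[x^-1] * expR (- x^-1) else 0.

(** With y = 1/x, bounding y^2 p(y) by C e^y amounts to bounding p(1/x) e^(-1/x) by C x^2; this
    makes the derivative at 0 vanish. *)
Lemma flat_le_sqr p : exists2 C, 0 <= C & forall x, `|flat p x| <= C * x ^+ 2.
Proof.
have [C C0 CP] := horner_le_expR ('X^2 * p); exists C => // x.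
rewrite /flat; case: ifPn => x0; last by rewrite normr0 mulr_ge0// sqr_ge0.
have y0 : 0 <= x^-1 by rewrite invr_ge0 ltW.
have x20 : 0 < x ^+ 2 by rewrite exprn_gt0.
have := CP _ y0; rewrite hornerM hornerXn normrM ger0_norm ?exprn_ge0// exprVn.
rewrite mulrC ler_pdivrMr// => h.
rewrite normrM [`|expR _|]ger0_norm ?expR_ge0// expRN ler_pdivrMr ?expR_gt0//.
by rewrite mulrAC.
Qed.

(** With y = 1/x one has dy/dx = - y^2, so p(y) e^(-y) has derivative y^2 (p(y) - p'(y)) e^(-y); at
    0 the quadratic bound applies. *)
Lemma is_derive_flat p x :
  is_derive x 1 (flat p) (flat ('X^2 * (p - p^`())) x).
Proof.
have [x0|x0|->] := ltgtP x 0.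
- rewrite /flat ltNge (ltW x0)/=.
  apply: (@near_eq_is_derive _ _ _ (cst 0)).
  by apply: filterS (lt_nbhsl x0) => y y0; rewrite ltNge (ltW y0).
- rewrite {2}/flat x0.
  pose i := fun y : R => y^-1.
  apply: (@near_eq_is_derive _ _ _ (fun y => p.[i y] * expR (- i y))).
    by apply: filterS (lt_nbhsr x0) => y y0; rewrite /flat y0.
  have xn0 : x != 0 by rewrite gt_eqF.
  have di : is_derive x 1 i (- x ^- 2).
    have := @derivableP _ _ _ _ _ _ (derivableV xn0 (@derivable_id _ _ x 1)).
    move=> h; apply: (is_derive_eq h).
    by rewrite deriveV// derive_id -[_ *: _]/(_ * _) mulr1.
  have dp : is_derive x 1 (fun y => p.[i y]) (p^`().[i x] * - x ^- 2).
    have dpo : is_derive (i x) 1 (horner p) p^`().[i x] by exact: is_derive_poly.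
    by apply: (is_derive_eq (is_derive_comp1 dpo di)); rewrite [LHS]mulrC.
  have de : is_derive x 1 (fun y => expR (- i y)) (expR (- i x) * x ^- 2).
    have dNi : is_derive x 1 (fun y => - i y) (x ^- 2).
      by apply: (is_derive_eq (is_deriveN di)); rewrite opprK.
    have dex : is_derive (- i x) 1 expR (expR (- i x)) by exact: is_derive_expR.
    have dc := @is_derive_comp1 _ _ expR (fun y => - i y) x _ _ dex dNi.
    by apply: (is_derive_eq dc); rewrite [LHS]mulrC.
  apply: (is_derive_eq (is_deriveM dp de)).
  rewrite -![_ *: _]/(_ * _) hornerM hornerXn hornerD hornerN exprVn /i.
  by move: (p.[_]) (p^`().[_]) (expR _) (x ^- 2) => A B E F; ring.
- rewrite {2}/flat ltxx; have [C C0 CP] := flat_le_sqr p.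
  have [|||df dE] := @quadratic_differentiable R _ _ (flat p) (\0 : {linear R -> R}) 0 1 C.
  + by move=> y; exact: cst_continuous.
  + exact: ltr01.
  + move=> h _; rewrite add0r /= subr0 {2}/flat ltxx subr0 (le_trans (CP h))//.
    by rewrite real_normK ?num_real.
  + by apply: DeriveDef; [exact/derivable1_diffP|rewrite dE].
Qed.

Lemma smooth_flat p : smooth setT (flat p).
Proof.
move=> k; elim: k p => [|k IHk] p.
  by move=> x _; exact: is_derive_continuous (is_derive_flat p x).
have dfl x : differentiable (flat p) x.
  by apply/derivable1_diffP; have [] := is_derive_flat p x.
split=> [x _ //|u].
rewrite (_ : 'D_u _ = fun x => u *: flat ('X^2 * (p - p^`())) x).
  by apply: Ck_scale; [exact: openT|exact: IHk].
apply/funext => x; rewrite -[X in 'D_X _ _]mulr1 -[_ * 1]/(_ *: 1) deriveE// linearZ.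
by rewrite -deriveE// (@derive_val _ _ _ _ _ _ _ (is_derive_flat p x)).
Qed.

Lemma smooth_step : exists sigma : R -> R, [/\ smooth setT sigma,
  forall x, 0 <= sigma x <= 1, forall x, x <= 0 -> sigma x = 0
  & forall x, 1 <= x -> sigma x = 1].
Proof.
pose e := flat 1.
have e_ge0 x : 0 <= e x.
  by rewrite /e /flat; case: ifP => // _; rewrite hornerE mul1r expR_ge0.
have e_gt0 x : 0 < x -> 0 < e x.
  by move=> x0; rewrite /e /flat x0 hornerE mul1r expR_gt0.
have e0 x : x <= 0 -> e x = 0 by move=> x0; rewrite /e /flat ltNge x0.
have d_gt0 x : 0 < e x + e (1 - x).
  have [x0|x0] := ltP 0 x; first by rewrite ltr_wpDr// e_gt0.
  by rewrite ltr_wpDl// e_gt0// subr_gt0 (le_lt_trans x0).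
exists (fun x => e x * (e x + e (1 - x))^-1); split.
- move=> k; have Ce := smooth_flat 1 k.
  have C1 : Ck k setT (fun x => e (1 - x)).
    apply: (@Ck_comp1 _ _ k setT e (fun x => 1 - x)) => //; first exact: openT.
    by apply: Ck_sub; [exact: openT|exact: Ck_cst|exact: Ck_id].
  apply: Ck_mul; [exact: openT|exact: Ce|].
  apply: Ck_inv; [exact: openT| |by apply: Ck_add; [exact: openT| |]].
  by move=> x _; rewrite gt_eqF.
- move=> x; rewrite divr_ge0 ?(ltW (d_gt0 x))//=.
  by rewrite ler_pdivrMr// mul1r lerDl.
- by move=> x x0; rewrite e0// mul0r.
- move=> x x1; rewrite [e (1 - x)]e0 ?subr_le0// addr0 divff// gt_eqF//.
  by rewrite e_gt0// (lt_le_trans ltr01).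
Qed.

End SmoothStep.

(** * Completeness from a conserved quantity *)

Section Completeness.
Context {R : realType} {n : nat}.
Implicit Types (x y : 'rV[R]_n) (f g h : 'rV[R]_n -> R) (v : 'rV[R]_n -> 'rV[R]_n)
  (r s t C T K : R).

Lemma derive_gradient f x d : differentiable f x -> 'D_d f x = dotv d (gradient f x).
Proof.
by move=> df; rewrite diff_rVE//; apply: eq_bigr => i _; rewrite mxE.
Qed.

Lemma smooth_gradient f : smooth setT f -> smooth setT (gradient f).
Proof.
move=> sf k; apply: Ck_rV => [|i]; first exact: openT.
rewrite (_ : (fun x => _) = 'D_(delta_mx 0 i) f); first exact: (sf k.+1).2.
by apply/funext => x; rewrite mxE.
Qed.

Lemma Ck_dotv (V : normedModType R) k (O : set V) (p q : V -> 'rV[R]_n) :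
  open O -> Ck k O p -> Ck k O q -> Ck k O (fun z => dotv (p z) (q z)).
Proof.
move=> oO Cp Cq; apply: Ck_sum => // i.
by apply: Ck_mul => //; exact: Ck_coord.
Qed.

Lemma cauchy_schwarz x y : dotv x y ^+ 2 <= dotv x x * dotv y y.
Proof.
have [y0|y0] := eqVneq (dotv y y) 0.
  have -> : y = 0.
    by apply/normr0_eq0/eqP; rewrite -sqrf_eq0 eq_le sqr_ge0 andbT -y0 sqr_norm_le_dotv.
  by rewrite -(scale0r 0) !dotvZr !(mul0r, mulr0) expr0n.
have yp : 0 < dotv y y by rewrite lt_neqAle eq_sym y0 dotv_ge0.
have := dotv_ge0 (dotv y y *: x + (- dotv x y) *: y).
rewrite !(dotvDl, dotvDr, dotvZl, dotvZr) (dotvC y x).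
set a := dotv x x; set b := dotv y y; set c := dotv x y => h.
have : 0 <= b * (a * b - c ^+ 2) by move: h; congr (_ <= _); ring.
by rewrite pmulr_rge0// subr_ge0.
Qed.

Lemma curve_dotv_bounded (y : R -> 'rV[R]_n) (dy : R -> 'rV[R]_n) T :
  (forall t, 0 <= t <= T -> is_derive t 1 y (dy t)) ->
  exists B, forall t, 0 <= t <= T -> dotv (y t) (y t) <= B.
Proof.
move=> dY; have [T0|T0] := ltP T 0.
  by exists 0 => t /andP[t0 tT]; have := le_lt_trans (le_trans t0 tT) T0; rewrite ltxx.
have [|c _ cmax] := @EVT_max R (fun t => dotv (y t) (y t)) 0 T T0.
  apply: (@is_derive_within_continuous _ _ (fun t => dotv (dy t) (y t) + dotv (y t) (dy t))).
  by move=> t /dY yd; exact: is_derive_dotv.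
by exists (dotv (y c) (y c)) => t tT; apply: cmax; rewrite in_itv.
Qed.

(* A curve reaching the inner ball (h = 0) shortly before time T cannot leave
   the outer one (h < 1) before T, since h varies at bounded speed; otherwise
   g is eventually constant along the curve, whence exponential growth. *)
Lemma forward_bounded v g h r C :
  (forall x, differentiable g x) -> (forall x, differentiable h x) ->
  (forall x, `|'D_(v x) h x| <= C) ->
  (forall x, dotv x x < r -> h x = 0) ->
  (forall x, h x < 1 -> dotv x x <= r + 1) ->
  (forall x, r <= dotv x x -> 'D_(v x) g x = 0) ->
  (forall s, exists2 K, 0 <= K &
     forall x, r <= dotv x x -> g x = s -> `|dotv x (v x)| <= K * dotv x x) ->
  forall T (y : R -> 'rV[R]_n), 0 < T ->
  (forall t, 0 <= t < T -> is_derive t 1 y (v (y t))) ->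
  exists B, forall t, 0 <= t < T -> dotv (y t) (y t) <= B.
Proof.
move=> dg dh hC h0 h1 vg vK T y T0 dy.
have C0 : 0 <= C := le_trans (normr_ge0 _) (hC 0).
have C1 : 0 < C + 1 by rewrite ltr_wpDl.
(* Over a time of at most 1 / (C + 1), [h] grows by at most C / (C + 1) < 1, hence cannot pass from
   0 to 1. *)
pose t1 := Num.max 0 (T - (C + 1)^-1).
have t1T : t1 < T by rewrite gt_max T0 gtrBl invr_gt0.
have t10 : 0 <= t1 by rewrite le_max lexx.
have t1C : T - t1 <= (C + 1)^-1.
  by rewrite lerBlDl -lerBlDr le_max lexx orbT.
have upto t2 : 0 <= t2 -> t2 < T ->
    exists B, forall t, 0 <= t <= t2 -> dotv (y t) (y t) <= B.
  move=> t20 t2T; apply: (@curve_dotv_bounded _ (fun t => v (y t))) => t /andP[t0 tt2].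
  by apply: dy; rewrite t0 (le_lt_trans tt2).
have dyI a b : 0 <= a -> b < T -> forall t, a <= t <= b -> is_derive t 1 y (v (y t)).
  move=> a0 bT t /andP[a_t tb]; apply: dy.
  by rewrite (le_trans a0 a_t) (le_lt_trans tb bT).
suff [t2 [t21 t2T [B BP]]] : exists t2, [/\ t1 <= t2, t2 < T &
    exists B, forall t, t2 <= t < T -> dotv (y t) (y t) <= B].
  have [B' BP'] := upto t2 (le_trans t10 t21) t2T.
  exists (Num.max B B') => t /andP[t0 tT]; rewrite le_max.
  by have [tt2|/ltW t2t] := leP t t2; [rewrite BP' ?orbT// t0|rewrite BP// t2t].
have [[t2 [/andP[t21 t2T] yt2]]|out] :=
    pselect (exists t2, t1 <= t2 < T /\ dotv (y t2) (y t2) < r).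
  exists t2; split=> //; exists (r + 1) => t /andP[t2t tT]; apply: h1.
  have : h (y t) - C * t <= h (y t2) - C * t2.
    apply: (@derive_le0_le _ (fun t => h (y t) - C * t)
      (fun t => 'D_(v (y t)) h (y t) - C)) => // s st; split; last first.
      by rewrite subr_le0 (le_trans (ler_norm _)).
    have ds := dyI _ _ (le_trans t10 t21) tT s st.
    exact: is_deriveB (is_derive_comp_curve (dh (y s)) ds) (is_derive_mull C s).
  rewrite (h0 _ yt2) sub0r => hle.
  have : C * (t - t2) < 1.
    apply: le_lt_trans (_ : C * (C + 1)^-1 < 1).
      by rewrite ler_wpM2l//; move: t1C t21 tT; lra.
    by rewrite ltr_pdivrMr// mul1r ltrDl.
  by move: hle; lra.
have {}out t : t1 <= t < T -> r <= dotv (y t) (y t).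
  by move=> tI; rewrite leNgt; apply/negP => yr; apply: out; exists t.
have gs t : t1 <= t < T -> g (y t) = g (y t1).
  move=> /andP[t1t tT].
  have dgy s : t1 <= s <= t -> is_derive s 1 (g \o y) 0.
    move=> st; have ds := dyI _ _ t10 tT s st.
    apply: (is_derive_eq (is_derive_comp_curve (dg (y s)) ds)); apply: vg.
    by case/andP: st => ? st; apply: out; apply/andP; split=> //; exact: le_lt_trans tT.
  apply/eqP; rewrite eq_le; apply/andP; split.
    exact: (@derive_le0_le _ (g \o y) (cst 0) t1 t t1t (fun s st => conj (dgy s st) (lexx 0))).
  rewrite -lerN2.
  apply: (@derive_le0_le _ (- (g \o y)) (cst 0) t1 t t1t) => s st; split=> //.
  by apply: (is_derive_eq (is_deriveN (dgy s st))); rewrite oppr0.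
have [K K0 KP] := vK (g (y t1)).
exists t1; split=> //; exists (dotv (y t1) (y t1) * expR (2 * K * T)) => t /andP[t1t tT].
pose u s := dotv (y s) (y s).
pose w s := u s * expR (- (2 * K) * s).
have : w t <= w t1.
  apply: (@derive_le0_le _ w (fun s => (2 * dotv (y s) (v (y s)) - 2 * K * u s)
                                       * expR (- (2 * K) * s))) => // s st.
  have ds := dyI _ _ t10 tT s st.
  split.
    apply: (is_derive_eq (is_deriveM (is_derive_dotv ds ds) (is_derive_expRM (- (2 * K)) s))).
    rewrite -![_ *: _]/(_ * _) (dotvC (v _)) /u; ring.
  rewrite mulr_le0_ge0 ?expR_ge0// subr_le0 -mulrA ler_wpM2l//.
  case/andP: st => t1s st; have sT := le_lt_trans st tT.
  by rewrite (le_trans (ler_norm _))// KP// ?gs ?out// t1s.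
rewrite /w !mulNr !expRN ler_pdivrMr ?expR_gt0// => h2.
apply: le_trans h2 _; rewrite -(mulrA (u t1)); apply: ler_wpM2l; first exact: dotv_ge0.
rewrite -expRN -expRD ler_expR.
by move: t10 t1t tT K0; nra.
Qed.

(** Backward times are forward times of y(-t), a solution for -v, and all hypotheses are invariant
    under v |-> -v. *)
Lemma bounded_solutions_of_conserved v g h r C :
  (forall x, differentiable g x) -> (forall x, differentiable h x) ->
  (forall x, `|'D_(v x) h x| <= C) ->
  (forall x, dotv x x < r -> h x = 0) ->
  (forall x, h x < 1 -> dotv x x <= r + 1) ->
  (forall x, r <= dotv x x -> 'D_(v x) g x = 0) ->
  (forall s, exists2 K, 0 <= K &
     forall x, r <= dotv x x -> g x = s -> `|dotv x (v x)| <= K * dotv x x) ->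
  bounded_solutions v.
Proof.
move=> dg dh hC h0 h1 vg vK T y T0 dy.
have DN f x : differentiable f x -> 'D_(- v x) f x = - 'D_(v x) f x.
  by move=> df; rewrite !deriveE// linearN.
have [|B1 B1P] := forward_bounded dg dh hC h0 h1 vg vK T0 (y := y).
  by move=> t /andP[t0 tT]; apply: dy; rewrite ger0_norm.
have [||||B2 B2P] := @forward_bounded (fun x => - v x) g h r C dg dh _ h0 h1 _ _ T
    (fun t => y (- t)) T0.
- by move=> x; rewrite DN// normrN.
- by move=> x xr; rewrite DN// vg// oppr0.
- move=> s; have [K K0 KP] := vK s; exists K => // x xr gx.
  by rewrite -scaleN1r dotvZr mulN1r normrN KP.
- move=> t /andP[t0 tT]; apply: is_derive_reverse; apply: dy.
  by rewrite normrN ger0_norm.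
exists (Num.max (1 + B1) (1 + B2)) => t tT; rewrite le_max.
have [t0|/ltW t0] := leP 0 t.
  by rewrite norm_le_dotv// B1P// t0 -(ger0_norm t0).
rewrite (@norm_le_dotv _ _ _ B2) ?orbT//.
by have := B2P (- t); rewrite opprK; apply; rewrite oppr_ge0 t0 -(ler0_norm t0).
Qed.

Lemma flow_shift v phi x s t : locally_lipschitz v -> is_flow v phi ->
  phi (phi x s) t = phi x (s + t).
Proof.
move=> lv fl.
have := @flow_unique _ _ v phi (fun r => phi x (s + r)) t lv fl.
rewrite addr0 => E; apply/esym/E => r _ {E}.
have ds : is_derive r 1 (fun r => s + r) 1.
  by apply: (is_derive_eq (is_deriveD (is_derive_cst s r 1) (is_derive_id r 1))); rewrite add0r.
apply: (is_derive_eq (@is_derive_comp1 _ _ (phi x) (fun r => s + r) r _ _ ((fl x).2 (s + r)) ds)).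
by rewrite scale1r.
Qed.

End Completeness.

(** * Motion of the values of f along the flow *)

Section UnitSpeed.
Context {R : realType}.
Implicit Types (a b s t y : R).

(** As F' lies in [0, 1], F stays between F 0 and F 0 + t, inside (a, b), where rho = 1; hence F' =
    1 throughout. *)
Lemma unit_speed_pos (F rho : R -> R) a b t :
  (forall s, is_derive s 1 F (rho (F s))) -> (forall y, 0 <= rho y <= 1) ->
  (forall y, a < y < b -> rho y = 1) ->
  0 <= t -> a < F 0 -> F 0 + t < b -> F t = F 0 + t.
Proof.
move=> dF rho01 rho1 t0 aF Fb.
have lo s : 0 <= s -> F 0 <= F s.
  move=> s0; rewrite -lerN2.
  apply: (@derive_le0_le _ (- F) (fun s => - rho (F s))) => // r _; split.
    exact: is_deriveN (dF r).
  by rewrite oppr_le0; case/andP: (rho01 (F r)).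
have dG s : is_derive s 1 (fun s => F s - s) (rho (F s) - 1).
  exact: is_deriveB (dF s) (is_derive_id s 1).
have hi s : 0 <= s -> F s <= F 0 + s.
  move=> s0; have : F s - s <= F 0 - 0.
    apply: (@derive_le0_le _ (fun s => F s - s) (fun s => rho (F s) - 1)) => // r _.
    by split; [exact: dG|rewrite subr_le0; case/andP: (rho01 (F r))].
  by lra.
apply/eqP; rewrite eq_le hi//=.
have : - (F t - t) <= - (F 0 - 0).
  apply: (@derive_le0_le _ (- (fun s => F s - s)) (fun s => - (rho (F s) - 1))) => //.
  move=> s /andP[s0 st]; split; first exact: is_deriveN (dG s).
  rewrite rho1 ?subrr ?oppr0//; apply/andP; split; first exact: lt_le_trans (lo _ s0).
  by apply: le_lt_trans (hi _ s0) _; move: Fb st; lra.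
by lra.
Qed.

(** Negative times reduce to positive ones through s |-> - F (- s), which reflects the interval. *)
Lemma unit_speed (F rho : R -> R) a b t :
  (forall s, is_derive s 1 F (rho (F s))) -> (forall y, 0 <= rho y <= 1) ->
  (forall y, a < y < b -> rho y = 1) ->
  a < F 0 < b -> a < F 0 + t < b -> F t = F 0 + t.
Proof.
move=> dF rho01 rho1 /andP[aF Fb] /andP[aFt Ftb].
have [t0|/ltW t0] := leP 0 t; first exact: unit_speed_pos dF rho01 rho1 t0 aF Ftb.
apply: oppr_inj.
have := @unit_speed_pos (fun s => - F (- s)) (fun y => rho (- y)) (- b) (- a) (- t).
rewrite oppr0 opprK opprD; apply.
- move=> s; rewrite opprK; have dFs := is_deriveN (is_derive_reverse (dF (- s))).
  by apply: (is_derive_eq dFs); rewrite opprK.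
- by move=> y.
- by move=> y /andP[by_ ya]; apply: rho1; rewrite ltrNr ya ltrNl by_.
- by rewrite oppr_ge0.
- by rewrite ltrN2.
- by rewrite -opprD ltrN2.
Qed.

End UnitSpeed.

(** * The trivializing field *)

Section MalgrangeField.
Context {R : realType} {n : nat}.
Implicit Types (x y : 'rV[R]_n) (f g h : 'rV[R]_n -> R) (s t : R).

Lemma enorm_le x (r : R) : 0 <= r -> (enorm x <= r) = (dotv x x <= r ^+ 2).
Proof.
move=> r0; rewrite /enorm -(@ler_pXn2r _ 2)// ?nnegrE ?sqrtr_ge0//.
by rewrite sqr_sqrtr// dotv_ge0.
Qed.

Lemma sqr_enorm x : enorm x ^+ 2 = dotv x x.
Proof. by rewrite sqr_sqrtr// dotv_ge0. Qed.

Lemma dotv_gt0 x : x != 0 -> 0 < dotv x x.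
Proof.
move=> x0; apply: lt_le_trans (sqr_norm_le_dotv x).
by rewrite exprn_gt0// normr_gt0.
Qed.

Lemma continuous_dist f l : smooth setT f -> continuous (fun x => `|f x - l|).
Proof.
move=> sf x; apply: (@continuous_comp _ _ _ (fun x => f x - l) (fun z => `|z|)).
  exact: (Ck_sub openT (sf 0%N) (Ck_cst 0%N setT l) x I).
exact: norm_continuous.
Qed.

(** Regularity concerns the fibre alone. It makes the continuous function |f - l| + |grad f|
    positive on the compact ball, and where |f - l| is below the minimum grad f cannot vanish. *)
Lemma regular_near f l (U : set R) (r : R) : smooth setT f -> regular_value f l ->
  open_nbhs l U -> 0 < r ->
  exists2 e, 0 < e & forall x, `|f x - l| < e ->
    U (f x) /\ (dotv x x <= r ^+ 2 -> gradient f x != 0).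
Proof.
move=> sf reg Ul r0.
have /nbhs_ballP[e1 /= e10 e1U] := open_nbhs_nbhs Ul.
pose H x := `|f x - l| + `|gradient f x|.
have cH : continuous H.
  suff CH : Ck 0 setT H by move=> x; exact: CH x I.
  rewrite /H; apply: Ck_add; [exact: openT|by move=> x _; exact: continuous_dist|].
  move=> x _; apply: (@continuous_comp _ _ _ (gradient f) (fun z => `|z|)).
    exact: smooth_gradient sf 0%N x I.
  exact: norm_continuous.
pose A := [set x : 'rV[R]_n | dotv x x <= r ^+ 2].
have A0 : A !=set0.
  by exists 0; rewrite /A /= -(scale0r 0) dotvZr mul0r sqr_ge0.
have cA : compact A.
  apply: bounded_closed_compact.
    exists (1 + r ^+ 2); split; first exact: num_real.
    by move=> M rM x xr; exact: le_trans (norm_le_dotv xr) (ltW rM).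
  rewrite (_ : A = (fun x => dotv x x) @^-1` [set s | s <= r ^+ 2])//.
  apply: closed_comp => [x _|]; last exact: closed_le.
  have cd := Ck_dotv openT (Ck_id 'rV[R]_n 0%N) (Ck_id _ 0%N).
  exact: cd x I.
have [c cA' cmin] := EVT_min_rV A0 cA (continuous_subspaceT cH).
have Hc : 0 < H c.
  rewrite lt_neqAle eq_sym addr_ge0// andbT; apply/negP.
  rewrite paddr_eq0// normr_eq0 subr_eq0 normr_eq0 => /andP[/eqP fc].
  exact/negP/reg.
exists (Num.min e1 (H c)); first by rewrite lt_min e10.
move=> x; rewrite lt_min => /andP[xe1 xH]; split.
  by apply: e1U; rewrite /ball/= distrC.
move=> xr; apply/eqP => gx0; have : H c <= H x by apply: cmin; rewrite inE.
by rewrite /H gx0 normr0 addr0 leNgt xH.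
Qed.

Lemma Ck_scale_fun (c : 'rV[R]_n -> R) (u : 'rV[R]_n -> 'rV[R]_n) k :
  Ck k setT c -> Ck k setT u -> Ck k setT (fun x => c x *: u x).
Proof.
move=> Cc Cu; apply: Ck_rV => [|i]; first exact: openT.
rewrite (_ : (fun x => _) = fun x => c x * u x 0 i).
  by apply: Ck_mul; [exact: openT|exact: Cc|exact: Ck_coord openT Cu].
by apply/funext => x; rewrite mxE.
Qed.

Lemma Ck_profile_dotv (sigma : R -> R) (c : R) k : smooth setT sigma ->
  Ck k setT (fun x : 'rV[R]_n => sigma (dotv x x - c)).
Proof.
move=> ss; apply: (@Ck_comp1 _ _ k setT sigma (fun x => dotv x x - c)) => //.
  exact: openT.
apply: Ck_sub; [exact: openT| |exact: Ck_cst].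
by apply: Ck_dotv; [exact: openT|exact: Ck_id|exact: Ck_id].
Qed.

(** The cutoff is constant for |x| > |c| + 1, so a compact ball determines the bound even if [v] is
    unbounded. This supplies the bounded speed of h in [forward_bounded]. *)
Lemma profile_derive_bounded (sigma : R -> R) (c : R) (v : 'rV[R]_n -> 'rV[R]_n) :
  smooth setT sigma -> (forall s, 1 <= s -> sigma s = 1) -> smooth setT v ->
  exists C, forall x, `|'D_(v x) (fun x => sigma (dotv x x - c)) x| <= C.
Proof.
move=> ss s1 sv; pose h x := sigma (dotv x x - c).
have sh : smooth setT h by move=> k; exact: Ck_profile_dotv.
have dh x : differentiable h x by exact: (sh 1%N).1.
have [|C C0 CP] := @continuous_bounded_ball R n
    (fun x => dotv (v x) (gradient h x)) (`|c| + 1).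
  have cd := Ck_dotv openT (sv 0%N) (smooth_gradient sh 0%N).
  by move=> x; exact: cd x I.
exists C => x; have [xc|xc] := leP `|x| (`|c| + 1).
  by rewrite derive_gradient//; exact: CP.
have hx : \near x, 1 = h x.
  have cn : {for x, continuous (fun z : 'rV[R]_n => `|z|)} by exact: norm_continuous.
  move: cn => /cvgr_gt /(_ _ xc); apply: filterS => z zc; rewrite /h s1//.
  by have := sqr_norm_le_dotv z; have := ler_norm c; have := normr_ge0 c; move: zc; nra.
rewrite -(near_eq_derive (v x) hx).
by rewrite (_ : 'D__ _ _ = 0) ?normr0//; exact: derive_cst.
Qed.

(* The squared Malgrange inequality for K = 1 / delta_s, with
   |grad_g f|^2 = (|b|^2 |a|^2 - <a, b>^2) / |b|^2 cleared of its denominator. *)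
Lemma malgrange_gram f g (S U : set R) l (r e : R) : 0 < r ->
  (forall x, malgrange_dom f U r x -> gradient g x != 0) ->
  malgrange_dom f U r `<=` g @^-1` S ->
  (forall s, S s -> exists2 delta : R, 0 < delta &
     forall x, malgrange_dom f U r x -> g x = s ->
       delta <= enorm (rel_gradient g f x) * enorm x) ->
  (forall x, `|f x - l| < e -> U (f x)) ->
  forall s, exists2 K, 0 <= K & forall x, `|f x - l| < e -> r ^+ 2 < dotv x x ->
    g x = s ->
    let a := gradient f x in let b := gradient g x in
    0 < dotv b b /\
    dotv b b <= K ^+ 2 * dotv x x * (dotv b b * dotv a a - dotv a b ^+ 2).
Proof.
move=> r0 m1 m2 m3 eU s.
have dom x : `|f x - l| < e -> r ^+ 2 < dotv x x -> malgrange_dom f U r x.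
  move=> xe xr; split; first exact: eU.
  by rewrite /= enorm_le ?(ltW r0)//; apply/negP; rewrite -ltNge.
(* Off S, condition (2) leaves no point of the domain on the level s, so any K serves. *)
have [Ss|Ss] := pselect (S s); last first.
  by exists 0 => // x xe xr gx; case: Ss; rewrite -gx; exact/m2/dom.
have [d d0 dP] := m3 s Ss; exists d^-1; first by rewrite invr_ge0 ltW.
move=> x xe xr gx a b; have xD := dom _ xe xr.
have b0 : 0 < dotv b b by apply: dotv_gt0; exact: m1.
split => //; have := dP _ xD gx.
set G := rel_gradient g f x => dG.
have : d ^+ 2 <= dotv G G * dotv x x.
  rewrite -!sqr_enorm -exprMn lerXn2r// nnegrE ?(ltW d0)//.
  exact: le_trans (ltW d0) dG.
have -> : dotv G G = (dotv b b * dotv a a - dotv a b ^+ 2) / dotv b b.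
  rewrite /G /rel_gradient sqr_enorm -/a -/b -scaleNr.
  rewrite !(dotvDl, dotvDr, dotvZl, dotvZr) (dotvC b a).
  move: (dotv a a) (dotv a b) (dotv b b) b0 => A C B B0; field.
  by rewrite gt_eqF.
move: (_ - _) => q.
rewrite mulrAC ler_pdivlMr// => h.
rewrite exprVn mulrAC -mulrA mulrC ler_pdivlMr ?exprn_gt0//.
by rewrite mulrC.
Qed.

Lemma malgrange_field f g (S : set R) l :
  smooth setT f -> smooth setT g -> regular_value f l -> malgrange_at g S f l ->
  exists (v : 'rV[R]_n -> 'rV[R]_n) (rho : R -> R) (eps : R),
  [/\ 0 < eps, smooth setT v, bounded_solutions v, forall s, 0 <= rho s <= 1 &
    (forall s, l - eps < s < l + eps -> rho s = 1) /\
    forall x, 'D_(v x) f x = rho (f x)].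
Proof.
move=> sf sg reg [U Ul [r r0 [m1 m2 m3]]].
have [e e0 eP] := regular_near sf reg Ul r0.
have eU x : `|f x - l| < e -> U (f x) by move=> /eP[].
have gram := malgrange_gram r0 m1 m2 m3 eU.
have [sigma [ss sigma01 sigma0 sigma1]] := @smooth_step R.
have df x : differentiable f x by exact: (sf 1%N).1.
have dg x : differentiable g x by exact: (sg 1%N).1.
pose a := gradient f; pose b := gradient g.
have sa : smooth setT a := smooth_gradient sf.
have sb : smooth setT b := smooth_gradient sg.
pose w x := dotv (b x) (b x) *: a x + (-1) *: (dotv (a x) (b x) *: b x).
(* The transition is confined to the shell r^2 < |x|^2 < r^2 + 1, where near the fibre both fields
   pair positively with grad f, so their convex combination does too. *)
pose sg' x := sigma (dotv x x - r ^+ 2).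
pose u x := (1 - sg' x) *: a x + sg' x *: w x.
pose q x := dotv (u x) (a x).
pose eps := e / 2.
have eps0 : 0 < eps by rewrite divr_gt0.
(* Squaring keeps the cutoff smooth at l. It is 1 for |y - l| <= eps and 0 from sqrt 2 * eps on; as
   sqrt 2 < 3/2 and e = 2 eps, rho(f) vanishes on a neighbourhood of the region |f - l| >= e, where
   [q] may vanish. *)
pose rho (y : R) := 1 - sigma (((y - l) / eps) ^+ 2 - 1).
pose c x := rho (f x) * (q x)^-1.
pose v x := c x *: u x.
have rho01 (y : R) : 0 <= rho y <= 1.
  by rewrite /rho subr_ge0 gerBl andbC; exact: sigma01.
have rho1 (y : R) : l - eps < y < l + eps -> rho y = 1.
  move=> /andP[y1 y2]; rewrite /rho sigma0 ?subr0// subr_le0.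
  rewrite exprMn exprVn ler_pdivrMr ?exprn_gt0// mul1r; nra.
have rho0 (y : R) : 3 / 2 * eps <= `|y - l| -> rho y = 0.
  move=> ye; rewrite /rho sigma1 ?subrr// lerBrDr.
  rewrite exprMn exprVn ler_pdivlMr ?exprn_gt0// -[(y - l) ^+ 2]real_normK ?num_real//.
  by move: ye eps0; move: `|y - l| => z; nra.
have sg01 x : 0 <= sg' x <= 1 by exact: sigma01.
have wa x : dotv (w x) (a x) =
    dotv (b x) (b x) * dotv (a x) (a x) - dotv (a x) (b x) ^+ 2.
  by rewrite dotvDl !dotvZl (dotvC (b x) (a x)); ring.
have wb x : dotv (w x) (b x) = 0 by rewrite dotvDl !dotvZl; ring.
have ww x : dotv (w x) (w x) = dotv (b x) (b x) * dotv (w x) (a x).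
  by rewrite {2}/w dotvDr !dotvZr wb !mulr0 addr0.
have qE x : q x = (1 - sg' x) * dotv (a x) (a x) + sg' x * dotv (w x) (a x).
  by rewrite /q /u dotvDl !dotvZl.
have q0 x : `|f x - l| < e -> 0 < q x.
  move=> xe; rewrite qE; have [xr|xr] := leP (dotv x x) (r ^+ 2).
    rewrite /sg' sigma0 ?subr_le0// subr0 mul1r mul0r addr0.
    exact/dotv_gt0/(eP _ xe).2.
  have [K K0 /(_ x xe xr erefl)/=[b0 bK]] := gram (g x).
  have G0 : 0 < dotv (w x) (a x).
    rewrite wa ltNge; apply/negP => G0; move: b0; rewrite ltNge; apply/negP/negPn.
    by apply: le_trans bK _; rewrite mulr_ge0_le0// mulr_ge0 ?sqr_ge0 ?dotv_ge0.
  have A0 : 0 < dotv (a x) (a x).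
    rewrite -(pmulr_rgt0 _ b0); apply: lt_le_trans G0 _.
    by rewrite wa gerBl sqr_ge0.
  by have := sg01 x; move: (sg' x) => z /andP[z0 z1]; nra.
have far x : e <= `|f x - l| -> rho (f x) = 0.
  by move=> xe; apply: rho0; apply: le_trans xe; rewrite /eps; move: e0; lra.
have vf x : 'D_(v x) f x = rho (f x).
  rewrite derive_gradient// /v dotvZl -/a -/(q x) /c.
  have [xe|/far ->] := ltP `|f x - l| e; last by rewrite !mul0r.
  by rewrite -mulrA mulVf ?mulr1// gt_eqF// q0.
have su : smooth setT u.
  have ssg : smooth setT sg' by move=> k; exact: Ck_profile_dotv.
  move=> k; apply: Ck_add; [exact: openT| |].
    apply: Ck_scale_fun; [|exact: sa].
    by apply: Ck_sub; [exact: openT|exact: Ck_cst|exact: ssg].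
  apply: Ck_scale_fun; [exact: ssg|].
  apply: Ck_add; [exact: openT| |].
    by apply: Ck_scale_fun; [apply: Ck_dotv; [exact: openT|exact: sb|exact: sb]|exact: sa].
  apply: Ck_scale; [exact: openT|].
  by apply: Ck_scale_fun; [apply: Ck_dotv; [exact: openT|exact: sa|exact: sb]|exact: sb].
have sq : smooth setT q.
  by move=> k; apply: Ck_dotv; [exact: openT|exact: su|exact: sa].
have srho : smooth setT rho.
  move=> k; rewrite /rho; apply: Ck_sub; [exact: openT|exact: Ck_cst|].
  apply: (@Ck_comp1 _ _ k setT sigma (fun y : R => ((y - l) / eps) ^+ 2 - 1)) => //.
    exact: openT.
  have Ci : Ck k setT (fun y : R => (y - l) / eps).
    apply: Ck_mul; [exact: openT| |exact: Ck_cst].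
    by apply: Ck_sub; [exact: openT|exact: Ck_id|exact: Ck_cst].
  apply: Ck_sub; [exact: openT| |exact: Ck_cst].
  exact: (Ck_mul openT Ci Ci).
have cf := @continuous_dist f l sf.
have sc : smooth setT c.
  (* The open sets |f - l| < e and |f - l| > 3/2 eps cover the space; [c] has a positive denominator
     on the first and is 0 on the second. *)
  move=> k; apply: Ck_local => x _; have [xe|xe] := ltP `|f x - l| e.
    pose A := [set x | `|f x - l| < e].
    have oA : open A.
      apply: (@open_comp _ _ (fun x => `|f x - l|) [set s | s < e]); last exact: open_lt.
      by move=> z _; exact: cf.
    exists A, c; split => //; apply: Ck_mul => //.
      apply: (@Ck_comp1 _ _ k A rho f) => //.
      exact: Ck_subset (@subsetT _ _) (sf k).
    apply: Ck_inv => //; first by move=> z zA; rewrite gt_eqF// q0.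
    exact: Ck_subset (@subsetT _ _) (sq k).
  pose A := [set x | 3 / 2 * eps < `|f x - l|].
  have oA : open A.
    apply: (@open_comp _ _ (fun x => `|f x - l|) [set s | 3 / 2 * eps < s]); last exact: open_gt.
    by move=> z _; exact: cf.
  exists A, (cst 0); split => //; [|exact: Ck_cst|].
    by split=> //; rewrite /A /=; apply: lt_le_trans xe; rewrite /eps; move: e0; lra.
  by move=> z /ltW/rho0 cz; rewrite /c cz mul0r.
have sv : smooth setT v by move=> k; apply: Ck_scale_fun; [exact: sc|exact: su].
exists v, rho, eps; split => //.
(* The profile is shifted to r^2 + 1 so that it grows only where the transition is over and [v] is a
   multiple of [w], hence tangent to the fibres of [g]. *)
have [C CP] := profile_derive_bounded (r ^+ 2 + 1) ss sigma1 sv.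
apply: (@bounded_solutions_of_conserved _ _ v g _ (r ^+ 2 + 1) C dg _ CP).
- by move=> x; exact: (@Ck_profile_dotv sigma (r ^+ 2 + 1) 1 ss).1.
- by move=> x xr; rewrite sigma0// subr_le0 ltW.
- move=> x; rewrite leNgt => hx; apply/negP => xr; move: hx.
  by rewrite sigma1 ?ltxx// lerBrDl ltW.
- move=> x xr; rewrite derive_gradient// /v dotvZl /u.
  rewrite /sg' sigma1; last by move: xr; lra.
  by rewrite subrr scale0r add0r scale1r wb mulr0.
- move=> s; have [K K0 KP] := gram s; exists K => // x xr gx.
  have [xe|/far xe] := ltP `|f x - l| e; last first.
    by rewrite /v /c xe mul0r scale0r -(scale0r 0) dotvZr mul0r normr0 mulr_ge0// dotv_ge0.
  have xr2 : r ^+ 2 < dotv x x by move: xr; lra.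
  have /=[b0 bK] := KP x xe xr2 gx.
  have uw : u x = w x.
    by rewrite /u /sg' sigma1 ?subrr ?scale0r ?add0r ?scale1r//; move: xr; lra.
  have qx := q0 x xe.
  have qw : q x = dotv (w x) (a x) by rewrite /q uw.
  (* The inequality is squared: <x, v>^2 <= |x|^2 |v|^2, where |v|^2 = rho^2 |b|^2 / <w, a> = rho^2
     / |grad_g f|^2 <= K^2 |x|^2. *)
  rewrite -(@ler_pXn2r _ 2)// ?nnegrE ?mulr_ge0 ?dotv_ge0// real_normK ?num_real//.
  apply: le_trans (cauchy_schwarz _ _) _.
  have cq : c x * (c x * (dotv (b x) (b x) * q x)) = rho (f x) ^+ 2 * (dotv (b x) (b x) / q x).
    by rewrite /c; field; rewrite gt_eqF.
  rewrite /v dotvZl dotvZr uw ww -qw cq.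
  rewrite [leRHS](_ : _ = dotv x x * (K ^+ 2 * dotv x x)); last by ring.
  apply: ler_wpM2l; first exact: dotv_ge0.
  apply: le_trans (_ : dotv (b x) (b x) / q x <= _).
    apply: ler_piMl; first by rewrite divr_ge0 ?dotv_ge0 ?(ltW qx).
    by have /andP[h0 h1] := rho01 (f x); rewrite expr_le1.
  by rewrite ler_pdivrMr// qw wa.
Qed.

End MalgrangeField.

(** * Trivialization along the flow *)

Section FlowComposition.
Context {R : realType} {n : nat}.

Lemma Ck_flow_comp (V : normedModType R) k (v : 'rV[R]_n -> 'rV[R]_n) phi
    (p : V -> 'rV[R]_n) (t : V -> R) :
  smooth setT v -> is_flow v phi -> Ck k setT p -> Ck k setT t ->
  Ck k setT (fun z => phi (p z) (t z)).
Proof.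
move=> sv fl Cp Ct.
pose m z : 'rV[R]_(n + 1) := row_mx (p z) (const_mx (t z)).
have Cm : Ck k setT m.
  apply: Ck_row_mx; [exact: openT|exact: Cp|].
  apply: Ck_rV => [|i]; first exact: openT.
  by rewrite (_ : (fun z => _) = t)//; apply/funext => z; rewrite mxE.
have := Ck_comp_rV openT openT (fun _ _ => I) (smooth_flow sv fl k) Cm.
congr (Ck _ _ _); apply/funext => z /=.
by rewrite /m row_mxKl row_mxKr mxE.
Qed.

End FlowComposition.

Theorem theorem3p1 (R : realType) (n : nat) (f g : 'rV[R]_n -> R)
    (f_smooth : smooth [set: 'rV[R]_n]%classic f)
    (g_smooth : smooth [set: 'rV[R]_n]%classic g)
    (S : set R) (S_open : open S)
    (lambda : R) (lambda_reg : regular_value f lambda)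
    (f_malgrange : malgrange_at g S f lambda) :
  exists2 U : set R, open_nbhs lambda U & trivial_fibration f lambda U.
Proof.
have [v [rho [eps [eps0 sv bv rho01 [rho1 vf]]]]] :=
  malgrange_field f_smooth g_smooth lambda_reg f_malgrange.
have lv := smooth_locally_lipschitz sv.
have [phi fl] : exists phi, is_flow v phi.
  by have [phi phiP] := choice (complete_field lv bv); exists phi.
pose U := [set s | lambda - eps < s < lambda + eps].
have Ul : U lambda by rewrite /U /= gtrBl ltrDl eps0.
(* Along a flow line f satisfies F' = rho(F), so it moves at unit speed in [U], and time s - f x
   brings it to s. *)
have fphi x s : U (f x) -> U s -> f (phi x (s - f x)) = s.
  move=> Ux Us; have [p0 dp] := fl x.
  have := @unit_speed R (f \o phi x) rho (lambda - eps) (lambda + eps) (s - f x).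
  rewrite /= p0 [f x + _]addrC subrK; apply => // r; rewrite -vf.
  exact: (is_derive_comp_curve ((f_smooth 1%N).1 _ I) (dp r)).
exists U.
  split => //; rewrite (_ : U = `]lambda - eps, lambda + eps[%classic).
    exact: itv_open.
  by apply/seteqP; split=> s /=; rewrite in_itv.
pose Psi x := (phi x (lambda - f x), f x).
(* On the fibre f p.1 = lambda; with f p.1 in place of lambda, [fphi] covers both maps. *)
pose Phi (p : 'rV[R]_n * R) := phi p.1 (p.2 - f p.1).
exists Psi; split; last by [].
split.
  (* As the flow is complete, both maps are smooth on the whole ambient space, which provides the
     local extensions. *)
  apply: smooth_smooth_on => k.
  apply: Ck_pair; [exact: openT| |exact: f_smooth].
  apply: (Ck_flow_comp sv fl (Ck_id _ k)).
  by apply: Ck_sub; [exact: openT|exact: Ck_cst|exact: f_smooth].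
exists Phi; split.
- apply: smooth_smooth_on => k; apply: (Ck_flow_comp sv fl (Ck_fst _ _ k)).
  apply: Ck_sub; [exact: openT|exact: Ck_snd|].
  exact: (Ck_comp openT (fun _ _ => I) (f_smooth k) (Ck_fst _ _ k)).
- move=> x Ux; have fE := fphi x lambda Ux Ul.
  split; first by split.
  rewrite /Phi /= fE (flow_shift _ _ _ lv fl).
  by rewrite addrA subrK subrr (fl x).1.
- move=> [y s] [/= fy Us]; have fE : f (phi y (s - f y)) = s by apply: fphi; rewrite ?fy.
  split; first by rewrite /Phi /= fE.
  rewrite /Psi /Phi /= fE (flow_shift _ _ _ lv fl).
  by rewrite fy addrA subrK subrr (fl y).1.
Qed.
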